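(* Let $\mathcal H$ and $\mathcal G$ be real separable Hilbert spaces. Let $A:\mathcal H\rightrightarrows\mathcal H$, $B:\mathcal G\rightrightarrows\mathcal G$ and $D:\mathcal G\rightrightarrows\mathcal G$ be maximally monotone operators such that $D$ is $\delta$-strongly monotone for some $\delta>0$, let $C:\mathcal H\to\mathcal H$ be a $\mu$-cocoercive operator for some $\mu>0$, and let $L:\mathcal H\to\mathcal G$ be a nonzero bounded linear operator with adjoint $L^*$. Let $m\ge 1$ be an integer and, for every $i\in\{1,\dots,m\}$, let $T_i:\mathcal H\to\mathcal H$ be an $\alpha_i$-averaged nonexpansive operator for some $\alpha_i\in\,]0,1[$. Set $S=\bigcap_{i=1}^m\operatorname{Fix}(T_i)$, let $Z_0$ be the set of all $(x,u)\in\mathcal H\times\mathcal G$ such that $$0\in Ax+L^*u+Cx\quad\text{and}\quad 0\in B^{-1}u-Lx+D^{-1}u,$$ and assume that $Z:=(S\times\mathcal G)\cap Z_0\neq\varnothing$. Let $\tau\in\,]0,2\mu[$ and $\gamma\in\,]0,2\delta[$ be such that $$\|L\|^2<\left(\frac1\gamma-\frac1{2\delta}\right)\left(\frac1\tau-\frac1{2\mu}\right).$$ Let $(x^0,\bar x^0,u^0)\in\mathcal H\times\mathcal H\times\mathcal G$ be such that $x^0=\bar x^0$, set $I=\{0,1,\dots,m\}$ and $T_0=\mathrm{Id}$. Let $(\epsilon_k)_{k\in\mathbb N}$ be a sequence of independent random variables on a probability space $(\Omega,\mathcal X,\mathbb P)$ such that, for every $k\in\mathbb N$, $\epsilon_k(\Omega)=I_k\subset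 I$, and consider the sequences defined, for every $k\in\mathbb N$, by $$\begin{aligned} u^{k+1}&=J_{\gamma B^{-1}}\bigl(u^k+\gamma(L\bar x^k-D^{-1}u^k)\bigr),\\ p^{k+1}&=J_{\tau A}\bigl(x^k-\tau(L^*u^{k+1}+Cx^k)\bigr),\\ x^{k+1}&=T_{\epsilon_{k+1}}p^{k+1},\\ \bar x^{k+1}&=x^{k+1}+p^{k+1}-x^k. \end{aligned}$$ Suppose that one of the following holds: (i) $Z_0\subset S\times\mathcal G$. (ii) There exists $N\in\mathbb N\smallsetminus\{0\}$ such that, for every $n\in\mathbb N$, $I=\bigcup_{k=n}^{n+N-1}I_k$, and $$0<\zeta:=\inf_{k\in\mathbb N}\ \min_{i\in I_k\smallsetminus\{0\}}\pi_k^i,$$ where, for every $k\in\mathbb N$ and $i\in I_k$, $\pi_k^i=\mathbb P(\epsilon_k^{-1}(\{i\}))$. Then $((x^k,u^k))_{k\in\mathbb N}$ converges weakly $\mathbb P$-almost surely to a $Z$-valued random variable.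
   Context: Conventions. A set-valued operator $M:\mathcal H\rightrightarrows\mathcal H$ is $\rho$-strongly monotone ($\rho\ge0$) if $\langle x-y\mid u-v\rangle\ge\rho\|x-y\|^2$ for all $(x,u),(y,v)$ in its graph; it is monotone if this holds with $\rho=0$; it is maximally monotone if it is monotone and its graph is maximal, for inclusion, among graphs of monotone operators; it is $\rho$-cocoercive if $M^{-1}$ is $\rho$-strongly monotone. Here $M^{-1}u=\{x: u\in Mx\}$. The resolvent of $M$ is $J_M=(\mathrm{Id}+M)^{-1}$, which is single-valued with full domain when $M$ is maximally monotone. Since $D$ is maximally monotone and strongly monotone, $D^{-1}$ is single-valued with full domain, and $D^{-1}u$ also denotes its unique value. For $\alpha\in\,]0,1[$, an operator $T:\mathcal H\to\mathcal H$ is $\alpha$-averaged nonexpansive if, for all $x,y\in\mathcal H$, $\|Tx-Ty\|^2\le\|x-y\|^2-\frac{1-\alpha}{\alpha}\|(\mathrm{Id}-T)x-(\mathrm{Id}-T)y\|^2$. $\operatorname{Fix}(T)$ is the set of fixed points of $T$. A minimum over the empty set is $+\infty$. The starting points $x^0,\bar x^0,u^0$ are deterministic. A random variable with values in a Hilbert space is a measurable map for the Borel $\sigma$-algebra. *)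

(* Defs.v *)
From HB Require Import structures.
From mathcomp Require Import all_boot all_order all_algebra.
From mathcomp Require Import all_classical all_reals all_analysis.

Set Implicit Arguments.
Unset Strict Implicit.
Unset Printing Implicit Defensive.

Import Order.TTheory GRing.Theory Num.Theory.
Import numFieldNormedType.Exports.

Local Open Scope classical_set_scope.
Local Open Scope ring_scope.

HB.mixin Record CompleteNormedModule_isHilbert (R : realType) V
    of CompleteNormedModule R V := {
  inner : {dot V for (@idfun R)} ;
  norm_inner : forall x : V, `|x| ^+ 2 = inner x x
}.

#[short(type="hilbertType")]
HB.structure Definition Hilbert (R : realType) :=
  {V of CompleteNormedModule R V & CompleteNormedModule_isHilbert R V}.

Definition separable (T : topologicalType) : Prop :=
  exists2 S : set T, countable S & dense S.

Section set_valued_operators.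
Context {R : realType} {V : hilbertType R}.
Implicit Types (M : V -> set V) (T : V -> V).

Definition graph M : set (V * V) := [set z | M z.1 z.2].

Definition inverse M : V -> set V := fun u => [set x | M x u].

Definition scale_op (c : R) M : V -> set V := fun x => [set c *: u | u in M x].

Definition id_plus M : V -> set V := fun x => [set x + u | u in M x].

Definition strongly_monotone (rho : R) M : Prop := forall x u y v,
  M x u -> M y v -> rho * `|x - y| ^+ 2 <= inner (x - y) (u - v).

Definition monotone M : Prop := strongly_monotone 0 M.

Definition maximally_monotone M : Prop :=
  monotone M /\
  forall M', monotone M' -> graph M `<=` graph M' -> graph M' = graph M.

Definition single_valued T : V -> set V := fun x => [set T x].

Definition cocoercive (rho : R) M : Prop := strongly_monotone rho (inverse M).

Definition resolvent M : V -> set V := inverse (id_plus M).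

(* The unique element of M x when M x is a singleton; 0 if M x is empty. *)
Definition value M : V -> V := fun x => xget 0 (M x).

Definition averaged (alpha : R) T : Prop := forall x y,
  `|T x - T y| ^+ 2 <=
    `|x - y| ^+ 2 - (1 - alpha) / alpha * `|(x - T x) - (y - T y)| ^+ 2.

Definition Fix T : set V := [set x | T x = x].

End set_valued_operators.

Section linear_operators.
Context {R : realType} {H G : hilbertType R}.

Definition opnorm (L : H -> G) : R := sup [set `|L x| | x in [set x | `|x| <= 1]].

(* For a bounded linear L, the Riesz representation theorem says that the set
   below is a singleton; 0 is the default value of xget. *)
Definition adjoint (L : H -> G) : G -> H := fun u =>
  xget 0 [set y | forall x, inner (L x) u = inner x y].

End linear_operators.

Section product_space.
Context {R : realType} {H G : hilbertType R}.

(* The library norms H * G with the maximum of the two norms, which induces the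
   same topology as the Hilbert direct sum norm but no inner product; the inner
   product of the direct sum is therefore given separately. *)
Definition dsum_inner (z w : H * G) : R := inner z.1 w.1 + inner z.2 w.2.

Definition dsum_weak_cvg (z : nat -> H * G) (l : H * G) : Prop :=
  forall w, (fun k => dsum_inner (z k) w) @ \oo --> dsum_inner l w.

Definition primal_dual_solutions (A : H -> set H) (B D : G -> set G)
    (C : H -> H) (L : H -> G) : set (H * G) :=
  [set z | [set a + adjoint L z.2 + C z.1 | a in A z.1] 0 /\
    [set b - L z.1 + d | b in inverse B z.2 & d in inverse D z.2] 0].

End product_space.

HB.instance Definition _ n := isPointed.Build 'I_n.+1 ord0.

HB.instance Definition _ n := @isMeasurable.Build default_measure_display
  'I_n.+1 discrete_measurable discrete_measurable0
  discrete_measurableC discrete_measurableU.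

Definition independent d d' (Omega : measurableType d) (E : measurableType d')
    (R : realType) (P : probability Omega R) (X : nat -> Omega -> E) : Prop :=
  forall (J : seq nat) (Y : nat -> set E), uniq J ->
    (forall k, measurable (Y k)) ->
    (P (\bigcap_(k in [set` J]) X k @^-1` Y k) =
      \prod_(k <- J) P (X k @^-1` Y k))%E.

(* Main.v *)
Require Import Defs.
From HB Require Import structures.
From mathcomp Require Import all_boot all_order all_algebra.
From mathcomp Require Import all_classical all_reals all_analysis.
From mathcomp Require Import measurable_realfun.
From mathcomp Require Import ring lra.

(** Every sample path is analysed on its own; probability enters only to show that
almost every path visits each operator T_i often enough.

Fix a path and a solution z = (xh, uh) of Z, and put q_0 = 0 and
q_(k+1) = x_k - p_(k+1), so that the extrapolated point is xbar_k = x_k - q_k.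
Adding the monotonicity inequalities of A and of the inverse of B at the two
resolvent steps, and using the cocoercivity of C and of the inverse of D to
absorb the forward terms, shows that the energy

  |x_k - xh|^2 / tau + |u_k - uh|^2 / gamma - 2 <u_k - uh, L q_k> + sx |q_k|^2,

with sx = 1/tau - 1/(2 mu), decreases at each step by an amount that, thanks to
the bound on the norm of L, dominates |q_k|^2, |u_(k+1) - u_k|^2,
|x_(k+1) - p_(k+1)|^2 and the squared defects of cocoercivity
([energy_step], [coercive_quadratic], [energy_decrease]). Hence all these
quantities tend to 0, C x_k and the value of the inverse of D at u_k converge
strongly, and the weighted squared distance from (x_k, u_k) to z converges.

Weak cluster points are taken along ultrafilters, along which every bounded
sequence converges weakly ([bounded_weak_ultra_cvg]). The strong limits above
and the maximal monotonicity of the product of A and of the inverse of B put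
every weak cluster point in Z_0 ([weak_cluster_solution]). Since the distances
to points of Z converge, the argument of Opial ([opial]) reduces weak
convergence to the membership of the weak cluster points in Z, that is, to their
being fixed by each T_i. Under condition (i) this is immediate.

Under condition (ii), the resolvent point p_(k+1) depends only on eps_1, ...,
eps_k, hence is independent of eps_(k+1), so that the expectation of
|p_(k+1) - T_eps p_(k+1)|^2 is the sum over i of P(eps_(k+1) = i) times the
expectation of |p_(k+1) - T_i p_(k+1)|^2. The energy bounds the sum over k of
the former by a constant, and zeta bounds the probabilities from below; so,
almost surely, the residuals |p_(k+1) - T_i p_(k+1)| of the operators with i in
I_(k+1) tend to 0 ([conditionally_summable_cvg0]). As p_(k+2) - p_(k+1) tends to
0 and every i occurs in every window of length N, the residuals of every T_i
tend to 0 along the whole sequence ([window_cvg0]), and demiclosedness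
([averaged_demiclosed]) concludes.

Three facts support this: Minty's theorem ([minty]), which makes the resolvents
and the inverse of D take values in the right sets, the representation theorem
of Riesz ([riesz]), which provides the adjoint of L and the weak limits, and the
measurability of the weak limit for the Borel sets, which rests on separability
([weakly_measurable_pair]). *)

Set Implicit Arguments.
Unset Strict Implicit.
Unset Printing Implicit Defensive.

Import Order.TTheory GRing.Theory Num.Theory.
Import numFieldNormedType.Exports.

Local Open Scope classical_set_scope.
Local Open Scope ring_scope.

Local Notation "''[' x , y ]" := (inner x y) : ring_scope.

(** * Inner products *)

Section inner_product.
Context {R : realType} {V : hilbertType R}.
Implicit Types x y z : V.

Lemma innerC x y : '[x, y] = '[y, x].
Proof. by have := hermC (@inner R V) x y; rewrite expr0 mul1r. Qed.

Lemma innerDl x y z : '[x + y, z] = '[x, z] + '[y, z].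
Proof. exact: linearDl. Qed.

Lemma innerDr x y z : '[z, x + y] = '[z, x] + '[z, y].
Proof. exact: linearDr. Qed.

Lemma innerNl x z : '[- x, z] = - '[x, z].
Proof. exact: linearNl. Qed.

Lemma innerNr x z : '[z, - x] = - '[z, x].
Proof. exact: linearNr. Qed.

Lemma innerZl (a : R) x z : '[a *: x, z] = a * '[x, z].
Proof. exact: linearZl_LR. Qed.

Lemma innerZr (a : R) x z : '[z, a *: x] = a * '[z, x].
Proof. exact: linearZr_LR. Qed.

Lemma inner0l z : '[0, z] = 0 :> R.
Proof. exact: linear0l. Qed.

Lemma inner0r z : '[z, 0] = 0 :> R.
Proof. exact: linear0r. Qed.

Definition innerE := (innerDl, innerDr, innerNl, innerNr, innerZl, innerZr).

Lemma inner_ge0 x : 0 <= '[x, x].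
Proof. by rewrite -norm_inner sqr_ge0. Qed.

Lemma inner_eq0 x : '[x, x] <= 0 -> x = 0.
Proof.
rewrite -norm_inner => h; apply/eqP; rewrite -normr_eq0 -sqrf_eq0.
by rewrite eq_le h sqr_ge0.
Qed.

Lemma inner_ext x y : (forall w, '[x, w] = '[y, w]) -> x = y.
Proof.
move=> xy; apply/eqP; rewrite -subr_eq0; apply/eqP/inner_eq0.
by rewrite innerDl innerNl xy subrr.
Qed.

Lemma cauchy_schwarz x y : `|'[x, y]| <= `|x| * `|y|.
Proof.
have [->|x0] := eqVneq x 0; first by rewrite inner0l normr0 normr0 mul0r.
have xx : 0 < `|x| by rewrite normr_gt0.
rewrite -(ler_pXn2r (n:=2)) ?nnegrE ?mulr_ge0// exprMn real_normK ?num_real//.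
have := inner_ge0 (`|x| ^+ 2 *: y - '[x, y] *: x).
rewrite !innerE (innerC y x) -!norm_inner => h.
suff : 0 <= `|x| ^+ 2 * (`|x| ^+ 2 * `|y| ^+ 2 - '[x, y] ^+ 2).
  by rewrite pmulr_rge0 ?exprn_gt0// subr_ge0.
by move: h; congr (_ <= _); ring.
Qed.

Lemma inner_le x y : '[x, y] <= `|x| * `|y|.
Proof. exact: le_trans (ler_norm _) (cauchy_schwarz x y). Qed.

End inner_product.

(** Pairing both sides with an arbitrary vector turns an identity between
    linear combinations of vectors into a linear identity between reals. *)
Ltac vector_eq := apply: inner_ext => ?; rewrite !innerE; lra.

(** The form in which the parallelogram identity delivers the Cauchy property of
    a minimizing sequence. *)
Lemma cvg_of_sqdist {R : realType} {V : completeNormedModType R} (x : nat -> V)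
    (e : nat -> R) :
  (forall n m, `|x n - x m| ^+ 2 <= e n + e m) -> e @ \oo --> 0 ->
  cvgn x.
Proof.
move=> xe e0; apply/cauchy_cvgP/cauchy_exP => _/posnumP[eps].
have [N _ h] : \forall n \near \oo, `|e n| < eps%:num ^+ 2 / 2.
  by move/cvgr0Pnorm_lt : e0; apply; rewrite divr_gt0// exprn_gt0.
exists (x N); exists N => // n /= Nn.
rewrite -ball_normE /= -(ltr_pXn2r (n:=2)) ?nnegrE//.
apply: le_lt_trans (xe _ _) _.
have := h n Nn; have := h N (leqnn N).
by rewrite /= !ltr_norml; lra.
Qed.

Section dsum.
Context {R : realType} {H G : hilbertType R}.
Implicit Types z w : H * G.

Lemma dsumC z w : dsum_inner z w = dsum_inner w z.
Proof. by rewrite /dsum_inner (innerC z.1) (innerC z.2). Qed.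

Lemma dsumDl a z w : dsum_inner (z + w) a = dsum_inner z a + dsum_inner w a.
Proof. by rewrite /dsum_inner /= !innerE addrACA. Qed.

Lemma dsumDr a z w : dsum_inner a (z + w) = dsum_inner a z + dsum_inner a w.
Proof. by rewrite dsumC dsumDl !(dsumC a). Qed.

Lemma dsumZl a (t : R) z : dsum_inner (t *: z) a = t * dsum_inner z a.
Proof. by rewrite /dsum_inner /= !innerE mulrDr. Qed.

Lemma dsumZr a (t : R) z : dsum_inner a (t *: z) = t * dsum_inner a z.
Proof. by rewrite dsumC dsumZl dsumC. Qed.

Lemma dsumNl a z : dsum_inner (- z) a = - dsum_inner z a.
Proof. by rewrite -scaleN1r dsumZl mulN1r. Qed.

Lemma dsumNr a z : dsum_inner a (- z) = - dsum_inner a z.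
Proof. by rewrite dsumC dsumNl dsumC. Qed.

Definition dsumE := (dsumDl, dsumDr, dsumNl, dsumNr, dsumZl, dsumZr).

Lemma dsum_ge0 z : 0 <= dsum_inner z z.
Proof. by rewrite addr_ge0 ?inner_ge0. Qed.

End dsum.

Lemma cvg_inner {R : realType} {V : hilbertType R} {T : Type}
    (F : set_system T) {FF : Filter F} (x y : T -> V) (a b : V) :
  x @ F --> a -> y @ F --> b -> (fun k => '[x k, y k]) @ F --> '[a, b].
Proof.
move=> xa yb.
have pol u v : '[u, v] = 2^-1 * (`|u + v| ^+ 2 - `|u| ^+ 2 - `|v| ^+ 2) :> R.
  by rewrite !norm_inner !innerE (innerC v u); lra.
rewrite pol; under eq_cvg do rewrite pol.
by rewrite !expr2; apply: cvgMl_tmp; apply: cvgB; first apply: cvgB;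
  apply: cvgM; apply: cvg_norm => //; exact: cvgD.
Qed.

(** * Minimization of a regularized supremum *)

Section regularized_minimization.
Context {R : realType} {H G : hilbertType R} (Phi : set (H * G -> R)).

Let bounds (z : H * G) (r : R) := forall phi, Phi phi -> phi z <= r.

(** The supremum F of a family of continuous affine functions is convex and
    lower semicontinuous, so F + |.|^2 / 2 has a minimizer z0 as soon as it is
    bounded below: strong convexity makes minimizing sequences Cauchy. The
    conclusion is the optimality condition that - z0 is a subgradient of F at
    z0. The values of F, which may be infinite, are replaced by their real upper
    bounds. The product carries the inner product of the direct sum, because the
    proof of Minty's theorem minimizes over pairs. *)
Lemma regularized_sup_min (c : R) :
  (forall phi, Phi phi -> continuous phi) ->
  (forall phi, Phi phi -> forall z w (t : R),
     phi (z + t *: (w - z)) = phi z + t * (phi w - phi z)) ->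
  (exists z r, bounds z r) ->
  (forall z r, bounds z r -> c <= r + dsum_inner z z / 2) ->
  exists z0 r0, bounds z0 r0 /\
    forall z r, bounds z r -> r0 - dsum_inner z0 (z - z0) <= r.
Proof.
move=> Phic Phia [z1 [r1 b1]] cP.
pose E := [set s | exists z r, bounds z r /\ s = r + dsum_inner z z / 2].
have hE : has_inf E.
  split; first by exists (r1 + dsum_inner z1 z1 / 2), z1, r1.
  by exists c => s [z [r [b ->]]]; exact: cP.
have lE z r : bounds z r -> inf E <= r + dsum_inner z z / 2.
  by move=> b; apply: ge_inf; [case: hE|exists z, r].
have seg z w t r r' : 0 <= t <= 1 -> bounds z r -> bounds w r' ->
    bounds (z + t *: (w - z)) (r + t * (r' - r)).
  move=> t01 bz bw phi Pphi; rewrite Phia//.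
  have := bz _ Pphi; have := bw _ Pphi => *; nra.
have app n : exists zr : (H * G) * R, bounds zr.1 zr.2 /\
    zr.2 + dsum_inner zr.1 zr.1 / 2 < inf E + harmonic n.
  have [s [z [r [b ->]]] lt] := inf_adherent (harmonic_gt0 n) hE.
  by exists (z, r).
have {app} [zr zrP] := choice app.
pose z n := (zr n).1; pose r n := (zr n).2.
have zC n k : dsum_inner (z n - z k) (z n - z k)
    <= 4 * harmonic n + 4 * harmonic k.
  have [bn en] := zrP n; have [bk ek] := zrP k.
  (* the midpoint of two almost minimizers does not go below the infimum *)
  have half : 0 <= (2^-1 : R) <= 1 by lra.
  have := lE _ _ (seg _ _ _ _ _ half bn bk).
  move: en ek; rewrite -/(z n) -/(z k) -/(r n) -/(r k) !dsumE (dsumC (z k) (z n)).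
  lra.
have e0 : (fun n => 4 * harmonic n : R) @ \oo --> (0 : R).
  by rewrite -[X in _ --> X](mulr0 4); apply: cvgMl_tmp; exact: cvg_harmonic.
have xc : cvgn (fun n => (z n).1).
  apply: cvg_of_sqdist e0 => n k; apply: le_trans (zC n k).
  by rewrite norm_inner /dsum_inner lerDl inner_ge0.
have uc : cvgn (fun n => (z n).2).
  apply: cvg_of_sqdist e0 => n k; apply: le_trans (zC n k).
  by rewrite norm_inner /dsum_inner lerDr inner_ge0.
pose z0 : H * G := (limn (fun n => (z n).1), limn (fun n => (z n).2)).
have zz0 : z @ \oo --> z0.
  rewrite (_ : z = fun n => ((z n).1, (z n).2)); first exact: (cvg_pair xc uc).
  by apply/funext => n; case: (z n).
have qz0 : (fun n => dsum_inner (z n) (z n)) @ \oo --> dsum_inner z0 z0.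
  by apply: cvgD; exact: cvg_inner.
have b0 : bounds z0 (inf E - dsum_inner z0 z0 / 2).
  move=> phi Pphi; rewrite -subr_le0.
  have h : (fun n => phi (z n) - (inf E - dsum_inner (z n) (z n) / 2)
      - harmonic n) @ \oo --> phi z0 - (inf E - dsum_inner z0 z0 / 2) - 0.
    apply: cvgB; last exact: cvg_harmonic.
    apply: cvgB; first by apply: cvg_comp zz0 _; exact: Phic.
    by apply: cvgB; [exact: cvg_cst|exact: cvgMr_tmp].
  rewrite subr0 in h; apply: cvgr_to_le h _.
  near=> n; have [bn en] := zrP n; have := bn _ Pphi.
  by move: en; rewrite -/(z n) -/(r n); lra.
exists z0, (inf E - dsum_inner z0 z0 / 2); split => // w s bw.
(* Fermat's rule along the segment from z0 to w, with the step sent to 0 *)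
set r0 := inf E - _ in b0 *; set Q := dsum_inner (w - z0) (w - z0).
have key (t : R) : 0 < t -> t <= 1 ->
    r0 - dsum_inner z0 (w - z0) <= s + t * Q / 2.
  move=> t0 t1; have t01 : 0 <= t <= 1 by rewrite ltW.
  have := lE _ _ (seg _ _ _ _ _ t01 b0 bw).
  rewrite dsumDl !(dsumDr _ z0) !dsumZl !dsumZr (dsumC (w - z0) z0) -/Q => h.
  rewrite -subr_ge0 -(pmulr_rge0 _ t0); move: h; rewrite /r0; lra.
rewrite leNgt; apply/negP => lt.
have Q0 : 0 <= Q by exact: dsum_ge0.
pose d := r0 - dsum_inner z0 (w - z0) - s.
have d0 : 0 < d by rewrite subr_gt0.
have dQ : 0 < d + Q by rewrite ltr_wpDr.
have t1 : d / (d + Q) <= 1 by rewrite ler_pdivrMr// mul1r lerDl.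
have := key _ (divr_gt0 d0 dQ) t1.
suff : d / (d + Q) * Q / 2 < d by rewrite /d; lra.
have -> : d / (d + Q) * Q / 2 = d * (Q / 2) / (d + Q) by lra.
by rewrite ltr_pdivrMr//; nra.
Unshelve. all: by end_near. Qed.

End regularized_minimization.

(** * Riesz representation and bounded operators *)

(** The minimizer of |x|^2 / 2 - f x represents f: at that point the optimality
    condition, tested in the directions y and - y, reads f y = <y, x>. *)
Lemma riesz {R : realType} {V : hilbertType R} (f : V -> R) (M : R) :
  (forall x y (t : R), f (x + t *: y) = f x + t * f y) ->
  (forall x, `|f x| <= M * `|x|) ->
  exists a, forall x, f x = '[a, x].
Proof.
move=> fl fM.
have fD x y : f (x - y) = f x - f y by rewrite -scaleN1r fl mulN1r.
have f0 : f 0 = 0 by have := fD 0 0; rewrite subr0 subrr.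
have [||||z0 [r0 [b0 opt]]] :=
    @regularized_sup_min R V V [set fun z => - f z.1] (- (M ^+ 2) / 2).
- move=> _ ->; move=> z; apply: cvgN; apply: cvg_sub0 (cvg_cst _).
  apply: norm_cvg0; apply: (@squeeze_cvgr _ _ _ _ (fun=> 0)
    (fun w => M * `|w.1 - z.1|)); [|exact: cvg_cst|].
    by near=> w; rewrite normr_ge0 /= -[X in `|X|]fD fM.
  rewrite -[X in _ --> X](mulr0 M); apply: cvgMl_tmp.
  by apply/norm_cvg0P/subr_cvg0; exact: cvg_fst.
- by move=> _ -> z w t; rewrite /= fl fD; lra.
- by exists 0, 0 => _ ->; rewrite f0 oppr0.
- move=> z r /(_ _ erefl); rewrite /dsum_inner -norm_inner.
  have := fM z.1; have := inner_ge0 z.2; have := sqr_ge0 (M - `|z.1|).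
  by rewrite ler_norml => ? ? /andP[]; nra.
exists z0.1 => x; have fz := b0 _ erefl.
have step (t : R) : t * f x <= t * '[z0.1, x].
  (* the point z0 + (t x, 0) with t = 1 and t = - 1 gives the two inequalities *)
  have bw phi : [set fun z => - f z.1] phi ->
      phi (z0 + (t *: x, 0)) <= - f (z0.1 + t *: x) by move=> ->.
  have := opt _ _ bw; rewrite addrAC subrr add0r /dsum_inner /= innerZr inner0r fl.
  lra.
by have := step 1; have := step (-1); lra.
Unshelve. all: by end_near. Qed.

Section bounded_operator.
Context {R : realType} {H G : hilbertType R} (L : {linear H -> G}).
Hypothesis bL : bounded_near L (nbhs (0 : H)).

(** The set from which [adjoint] chooses is nonempty by [riesz]. *)
Lemma adjointP u x : '[L x, u] = '[x, adjoint L u].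
Proof.
have /linear_boundedP/pinfty_ex_gt0[M M0 LM] := bL.
have [||a aP] := @riesz R H (fun x => '[L x, u]) (M * `|u|).
- by move=> y z t; rewrite linearD linearZ !innerE.
- move=> y; apply: le_trans (cauchy_schwarz _ _) _.
  by rewrite mulrAC ler_wpM2r.
have : [set y | forall x, '[L x, u] = '[x, y]] (adjoint L u).
  by apply: xgetPex; exists a => y; rewrite aP innerC.
exact.
Qed.

Lemma adjointB u v : adjoint L (u - v) = adjoint L u - adjoint L v.
Proof.
apply: inner_ext => x.
by rewrite innerC -adjointP !innerE -!(innerC x) -!adjointP.
Qed.

Lemma opnorm_has_ubound : has_ubound [set `|L x| | x in [set x | `|x| <= 1]].
Proof.
have /linear_boundedP/pinfty_ex_gt0[M M0 LM] := bL.
exists M => _ [y y1 <-]; apply: le_trans (LM y) _.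
by rewrite -[leRHS]mulr1 ler_pM2l.
Qed.

Lemma opnormP x : `|L x| <= opnorm L * `|x|.
Proof.
have [->|x0] := eqVneq x 0; first by rewrite linear0 !normr0 mulr0.
have nx : 0 < `|x| by rewrite normr_gt0.
rewrite -ler_pdivrMr// mulrC -[X in X * _]gtr0_norm ?invr_gt0// -normrZ -linearZ.
apply: ub_le_sup opnorm_has_ubound _ _; exists (`|x|^-1 *: x) => //=.
by rewrite normrZ gtr0_norm ?invr_gt0// mulVf ?gt_eqF.
Qed.

End bounded_operator.

(** * Maximal monotonicity and the theorem of Minty *)

Section maximal_monotonicity.
Context {R : realType} {V : hilbertType R}.
Implicit Types M : V -> set V.

Lemma monotoneP M x u y v :
  Defs.monotone M -> M x u -> M y v -> 0 <= '[x - y, u - v].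
Proof. by move=> mM Mx My; have := mM _ _ _ _ Mx My; rewrite mul0r. Qed.

(** For a monotone operator this is maximality, in the form in which it is used:
    a pair that is monotonically related to the graph belongs to the graph. *)
Definition monotonically_complete M := forall x u,
  (forall y v, M y v -> 0 <= '[x - y, u - v]) -> M x u.

(** Adding the pair (x, u) to the graph keeps it monotone. *)
Lemma maximally_monotone_complete M :
  maximally_monotone M -> monotonically_complete M.
Proof.
move=> [mM maxM] x u xu.
pose M' y : set V := M y `|` [set v | y = x /\ v = u].
have /maxM : Defs.monotone M'.
  move=> y v y' v' My My'; rewrite mul0r.
  case: My => [My|[-> ->]]; case: My' => [My'|[-> ->]].
  - exact: monotoneP mM My My'.
  - by rewrite -(opprB x) -(opprB u) innerNl innerNr opprK; exact: xu.
  - exact: xu.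
  - by rewrite !subrr inner0l.
move=> /(_ (fun _ => @or_introl _ _)) /seteqP[/(_ (x, u)) + _].
by apply; right.
Qed.

Lemma inverse_monotone_complete M :
  Defs.monotone M -> monotonically_complete M ->
  Defs.monotone (inverse M) /\ monotonically_complete (inverse M).
Proof.
move=> mM cM; split => [x u y v Mx My|x u xu].
  by rewrite mul0r innerC; exact: monotoneP mM Mx My.
by apply: cM => y v My; rewrite innerC; exact: xu.
Qed.

(** The theorem of Minty at the origin. The Fitzpatrick function F (x, u) = sup
    { <x, v> + <y, u> - <y, v> : v \in M y } satisfies F (x, u) >= <x, u>
    everywhere by maximality, so F + |.|^2 / 2 >= 0, and it has a minimizer (x0,
    u0) by [regularized_sup_min]. The optimality condition tested at the points
    of the graph, where F (y, v) = <y, v>, says that (- u0, - x0) is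
    monotonically related to M with the margin |x0 + u0|^2. So (- u0, - x0) is
    in the graph, and testing the margin at this very point gives u0 = - x0. *)
Lemma minty M : Defs.monotone M -> monotonically_complete M ->
  exists x, M x (- x).
Proof.
move=> mM cM.
pose fitz (y v : V) (z : V * V) : R := '[z.1, v] + '[y, z.2] - '[y, v].
pose Phi := [set phi | exists y v, M y v /\ phi = fitz y v].
have gap z y v : '[z.1, z.2] - fitz y v z = '[z.1 - y, z.2 - v].
  by rewrite /fitz !innerE; lra.
have fitz_ge z r : (forall phi, Phi phi -> phi z <= r) -> '[z.1, z.2] <= r.
  move=> b; have [|] := pselect (M z.1 z.2) => [Mz|nMz].
    have := b _ (ex_intro _ _ (ex_intro _ _ (conj Mz erefl))).
    by rewrite /fitz; lra.
  have : ~ forall y v, M y v -> 0 <= '[z.1 - y, z.2 - v] by move/cM.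
  move=> /existsNP[y /existsNP[v /not_implyP[My /negP]]].
  rewrite -ltNge -gap => lt.
  by have := b _ (ex_intro _ y (ex_intro _ v (conj My erefl))); lra.
(* the empty graph is not maximal *)
have [a [b Mab]] : exists a b, M a b.
  apply: contrapT => h; apply: (h); exists 0, 0.
  by apply: cM => y v My; exfalso; apply: h; exists y, v.
have [||||z0 [r0 [b0 opt]]] := @regularized_sup_min R V V Phi 0.
- move=> _ [y [v [_ ->]]] z; apply: cvgB; last exact: cvg_cst.
  apply: cvgD; apply: cvg_inner; try exact: cvg_cst.
    exact: cvg_fst.
  exact: cvg_snd.
- by move=> _ [y [v [_ ->]]] z w t; rewrite /fitz /= !innerE; lra.
- exists (a, b), '[a, b] => _ [y [v [My ->]]].
  by have := monotoneP mM Mab My; rewrite -(gap (a, b)) /=; lra.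
- move=> z r /fitz_ge h; rewrite /dsum_inner.
  by have := inner_ge0 (z.1 + z.2); rewrite !innerE (innerC z.2 z.1); lra.
have Fz := fitz_ge _ _ b0.
have rel y v : M y v ->
    '[z0.1 + z0.2, z0.1 + z0.2] <= '[- z0.2 - y, - z0.1 - v].
  move=> My; have := opt (y, v) '[y, v].
  have bM phi : Phi phi -> phi (y, v) <= '[y, v].
    move=> [y' [v' [My' ->]]].
    by have := monotoneP mM My My'; rewrite -(gap (y, v)) /=; lra.
  move=> /(_ bM); move: Fz; rewrite /dsum_inner /= !innerE.
  by rewrite (innerC z0.2 z0.1) (innerC z0.2 v) (innerC y z0.1); lra.
have Mz : M (- z0.2) (- z0.1).
  by apply: cM => y v /rel; apply: le_trans; exact: inner_ge0.
have := rel _ _ Mz; rewrite !subrr inner0l => /inner_eq0/eqP.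
rewrite addr_eq0 => /eqP e; exists z0.1; rewrite {1}e; exact: Mz.
Qed.

(** [minty] applied to the operator x |-> c (M x) - w: a zero of its sum with
    the identity is a point of the resolvent of c M at w. *)
Lemma resolvent_neq0 (c : R) M w : 0 < c ->
  Defs.monotone M -> monotonically_complete M ->
  exists x, resolvent (scale_op c M) w x.
Proof.
move=> c0 mM cM.
have cN0 : c != 0 by rewrite gt_eqF.
have [||x Mx] := @minty (fun x => [set u | M x (c^-1 *: (u + w))]).
- move=> x u y v Mx My; rewrite mul0r.
  have := monotoneP mM Mx My.
  by rewrite -scalerBr innerZr opprD addrACA subrr addr0 pmulr_rge0 ?invr_gt0.
- move=> x u xu; apply: cM => y v My.
  have := xu y (c *: v - w); rewrite /= subrK scalerK// => /(_ My).
  rewrite opprB addrA (_ : u + w - c *: v = c *: (c^-1 *: (u + w) - v)).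
    by rewrite innerZr pmulr_rge0.
  by rewrite scalerBr scalerA mulfV// scale1r.
exists x; rewrite /resolvent /inverse /id_plus /scale_op /=.
exists (c *: (c^-1 *: (- x + w))); first by exists (c^-1 *: (- x + w)).
by rewrite scalerA mulfV// scale1r addNKr.
Qed.

Lemma resolvent_inclusion (c : R) M w : 0 < c ->
  Defs.monotone M -> monotonically_complete M ->
  M (value (resolvent (scale_op c M)) w)
    (c^-1 *: (w - value (resolvent (scale_op c M)) w)).
Proof.
move=> c0 mM cM; have [x0 x0P] := resolvent_neq0 w c0 mM cM.
have : resolvent (scale_op c M) w (value (resolvent (scale_op c M)) w).
  exact: xgetPex (ex_intro _ _ x0P).
move: (value _ w) => x [_ [u Mu <-] <-].
by rewrite addrAC subrr add0r scalerA mulVf ?gt_eqF// scale1r.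
Qed.

(** Strong monotonicity makes x |-> (M x - w) / rho - x monotone, and [minty]
    for this operator says that w is in the range of M. *)
Lemma inverse_inclusion (rho : R) M w : 0 < rho ->
  strongly_monotone rho M -> monotonically_complete M ->
  M (value (inverse M) w) w.
Proof.
move=> r0 sM cM; have rN0 : rho != 0 by rewrite gt_eqF.
suff [x Mx] : exists x, M x w by apply: (@xgetPex _ 0 (inverse M w)); exists x.
(* at u = - x the argument of M x reduces to w *)
have [||x] := @minty (fun x => [set u | M x (rho *: (x + u) + w)]).
- move=> x u y v Mx My; rewrite mul0r.
  have := sM _ _ _ _ Mx My; rewrite opprD addrACA subrr addr0 -scalerBr opprD addrACA.
  by rewrite innerZr norm_inner ler_pM2l// [leRHS]innerDr lerDl.
- move=> x u xu; apply: cM => y v My; pose v' := rho^-1 *: (v - w) - y.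
  have vE : v = rho *: (y + v') + w.
    by rewrite (addrC y) subrK scalerA mulfV// scale1r subrK.
  have := xu y v'; rewrite /= -vE => /(_ My) h.
  rewrite vE opprD addrACA subrr addr0 -scalerBr opprD addrACA.
  by rewrite innerZr innerDr mulr_ge0 ?addr_ge0 ?inner_ge0// ltW.
by rewrite /= subrr scaler0 add0r; exists x.
Qed.

End maximal_monotonicity.

(** * Weak convergence along filters and the lemma of Opial *)

Section ultrafilters.

(** On an ultrafilter, clustering at a point is converging to it. *)
Lemma ultra_cvg {T : Type} {X : topologicalType} (F : set_system T)
    (f : T -> X) (K : set X) :
  UltraFilter F -> compact K -> (forall k, K (f k)) -> exists2 p, K p & f @ F --> p.
Proof.
move=> UF cK Kf; have PF : ProperFilter F by exact: ultra_proper.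
have FK : F (f @^-1` K) by apply: filterS (@filterT _ F _) => k _; exact: Kf.
have [p [Kp clp]] := cK (f @ F) _ FK.
exists p => // A Ap.
have [//|FA] := in_ultra_setVsetC (f @^-1` A) UF.
have /(_ FA Ap)[y [/= nAy Ay]] := clp (~` A) A.
by [].
Qed.

(** Convergence along a filter can be tested on the finer ultrafilters: if the
    preimage of a neighbourhood is not in F, then F and its complement generate
    a proper filter, hence lie in a common ultrafilter. *)
Lemma cvg_ultraP {T : Type} {X : topologicalType} (F : set_system T)
    {FF : Filter F} (f : T -> X) (p : X) :
  (forall U, UltraFilter U -> F `<=` U -> f @ U --> p) -> f @ F --> p.
Proof.
move=> h A Ap; apply: contrapT => nFA.
pose D := ~` (f @^-1` A).
have PG : ProperFilter (within D F).
  apply: Build_ProperFilter_ex => B; rewrite /within /= => FB.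
  apply: contrapT => nB; apply: nFA; apply: filterS FB => k DB.
  by apply: contrapT => nA; apply: nB; exists k; apply: DB.
have [U [UU GU]] := ultraFilterLemma PG.
have PU : ProperFilter U by exact: ultra_proper.
have FU : F `<=` U by move=> B FB; apply: GU; apply: filterS FB => k Bk _.
have UA : U (f @^-1` A) by exact: (h U UU FU A Ap).
have UD : U D by apply: GU; apply: filterS (@filterT _ F _).
by have [k [Ak Dk]] := filter_ex (filterI UA UD); exact: (Dk Ak).
Qed.

End ultrafilters.

Section weak_convergence.
Context {R : realType}.

Definition weak_cvg {V : hilbertType R} {T : Type} (F : set_system T)
    (x : T -> V) (l : V) :=
  forall w, (fun k => '[x k, w]) @ F --> '[l, w].

Context {T : Type} (F : set_system T) {FF : ProperFilter F}.

Lemma weak_cvg_inner {V : hilbertType R} (M : R) (x y : T -> V) (a b : V) :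
  (\forall k \near F, `|x k| <= M) -> weak_cvg F x a -> y @ F --> b ->
  (fun k => '[x k, y k]) @ F --> '[a, b].
Proof.
move=> xM xa yb; apply: cvg_sub0 (xa b).
apply: norm_cvg0; apply: (@squeeze_cvgr _ _ _ _ (fun=> 0)
    (fun k => M * `|y k - b|)); [|exact: cvg_cst|].
  near=> k; rewrite normr_ge0 /= -[X in `|X|]/('[x k, y k] - '[x k, b]).
  rewrite -innerNr -innerDr.
  apply: le_trans (cauchy_schwarz _ _) _; rewrite ler_wpM2r//.
  by near: k.
rewrite -[X in _ --> X](mulr0 M); apply: cvgMl_tmp.
by apply/norm_cvg0P/subr_cvg0.
Unshelve. all: by end_near. Qed.

Lemma weak_cvgD {V : hilbertType R} (x y : T -> V) (a b : V) :
  weak_cvg F x a -> weak_cvg F y b -> weak_cvg F (fun k => x k + y k) (a + b).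
Proof.
by move=> xa yb w; rewrite innerDl; under eq_cvg do rewrite innerDl; exact: cvgD.
Qed.

Lemma cvg_weak {V : hilbertType R} (x : T -> V) (a : V) :
  x @ F --> a -> weak_cvg F x a.
Proof. by move=> xa w; apply: cvg_inner => //; exact: cvg_cst. Qed.

Lemma weak_cvg_shift {V : hilbertType R} (x y : T -> V) (a : V) :
  weak_cvg F x a -> (fun k => y k - x k) @ F --> 0 -> weak_cvg F y a.
Proof.
move=> xa /cvg_weak/(weak_cvgD xa); rewrite addr0.
by rewrite (_ : (fun k => x k + _) = y)//; apply/funext => k; rewrite addrC subrK.
Qed.

(** Along an ultrafilter, each bounded real sequence <x_k, w> has a limit; the
    limit is linear and bounded in w, so that Riesz turns it into a vector. This
    replaces the extraction of weakly convergent subsequences. *)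
Lemma bounded_weak_ultra_cvg {V : hilbertType R} (M : R) (x : T -> V) :
  UltraFilter F -> (forall k, `|x k| <= M) -> exists l, weak_cvg F x l.
Proof.
move=> UF xM.
have lim_ex w : exists l : R, `|l| <= M * `|w| /\ (fun k => '[x k, w]) @ F --> l.
  have [||l /= lM fl] := @ultra_cvg _ _ F (fun k => '[x k, w])
    `[(- (M * `|w|)), (M * `|w|)]%classic UF.
  - exact: segment_compact.
  - move=> k; rewrite /= in_itv /= -ler_norml.
    by apply: le_trans (cauchy_schwarz _ _) _; rewrite ler_wpM2r.
  by exists l; split => //; move: lM; rewrite /= in_itv /= -ler_norml.
have [f fP] := choice lim_ex.
have [||l lP] := @riesz R V f M.
- move=> a b t.
  have h : (fun k => '[x k, a + t *: b]) @ F --> f a + t * f b.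
    under eq_cvg do rewrite innerDr innerZr.
    by apply: cvgD; [exact: (fP _).2|apply: cvgMl_tmp; exact: (fP _).2].
  exact: (cvg_unique _ (fP _).2 h).
- by move=> w; exact: (fP w).1.
by exists l => w; rewrite -lP; exact: (fP w).2.
Qed.

End weak_convergence.

Section opial.
Context {R : realType} {H G : hilbertType R}.
Variables (x : nat -> H) (u : nat -> G) (a b M : R) (W : set (H * G)).
Hypotheses (a0 : 0 < a) (b0 : 0 < b).
Hypotheses (xM : forall k, `|x k| <= M) (uM : forall k, `|u k| <= M).

Let dist z k := a * `|x k - z.1| ^+ 2 + b * `|u k - z.2| ^+ 2.

(** If z and z0 are two weak cluster points, the difference of the squared
    distances to z and to z0 is affine in (x_k, u_k) and converges along the
    whole sequence. Its limit, computed along the two ultrafilters, forces z =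
    z0. All ultrafilters then have the same weak limit, which is the weak limit
    of the sequence. The weights a and b make the distance that of the metric in
    which the algorithm is Fejer monotone. *)
Lemma opial : W !=set0 ->
  (forall z, W z -> cvgn (dist z)) ->
  (forall F, ProperFilter F -> \oo `<=` F -> forall z,
     weak_cvg F x z.1 -> weak_cvg F u z.2 -> W z) ->
  exists2 z, W z & weak_cvg \oo x z.1 /\ weak_cvg \oo u z.2.
Proof.
move=> W0 distc clW.
have ultra_lim U : UltraFilter U -> \oo `<=` U ->
    exists z, [/\ W z, weak_cvg U x z.1 & weak_cvg U u z.2].
  move=> UU oU; have PU := ultra_proper.
  have [x' xx'] := bounded_weak_ultra_cvg UU xM.
  have [u' uu'] := bounded_weak_ultra_cvg UU uM.
  by exists (x', u'); split => //; exact: (clW U _ _ (x', u')).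
have [U0 [UU0 oU0]] := ultraFilterLemma (@eventually_filter).
have [z0 [Wz0 xz0 uz0]] := ultra_lim U0 UU0 oU0.
have uniq U z : UltraFilter U -> \oo `<=` U -> W z -> weak_cvg U x z.1 ->
    weak_cvg U u z.2 -> z = z0.
  move=> UU oU Wz xz uz.
  pose g k := dist z k - dist z0 k.
  have gc : cvgn g by apply: is_cvgB; exact: distc.
  (* expanding the squares leaves an affine function of the iterates *)
  have glim F z' : ProperFilter F -> \oo `<=` F -> weak_cvg F x z'.1 ->
      weak_cvg F u z'.2 ->
      limn g = - 2 * a * '[z'.1, z.1 - z0.1] - 2 * b * '[z'.2, z.2 - z0.2] +
        (a * ('[z.1, z.1] - '[z0.1, z0.1]) + b * ('[z.2, z.2] - '[z0.2, z0.2])).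
    move=> PF oF xF uF.
    have gF : g @ F --> limn g by apply: cvg_trans gc => A; exact: oF.
    apply: cvg_unique gF _ => //=.
    have gE k : g k = - 2 * a * '[x k, z.1 - z0.1] - 2 * b * '[u k, z.2 - z0.2] +
        (a * ('[z.1, z.1] - '[z0.1, z0.1]) + b * ('[z.2, z.2] - '[z0.2, z0.2])).
      rewrite /g /dist !norm_inner !innerE (innerC z.1 (x k)) (innerC z0.1 (x k)).
      by rewrite (innerC z.2 (u k)) (innerC z0.2 (u k)); ring.
    under eq_cvg do rewrite gE.
    apply: cvgD; last exact: cvg_cst.
    by apply: cvgB; apply: cvgMl_tmp.
  have PU : ProperFilter U by exact: ultra_proper.
  have PU0 : ProperFilter U0 by exact: ultra_proper.
  have := glim U z PU oU xz uz; rewrite (glim U0 z0 PU0 oU0 xz0 uz0).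
  rewrite !innerE (innerC z0.1 z.1) (innerC z0.2 z.2) => e.
  have := inner_ge0 (z.1 - z0.1); have := inner_ge0 (z.2 - z0.2).
  have s : a * '[z.1 - z0.1, z.1 - z0.1] + b * '[z.2 - z0.2, z.2 - z0.2] = 0.
    by rewrite !innerE (innerC z0.1 z.1) (innerC z0.2 z.2); lra.
  move=> h2 h1.
  have [e1 e2] : '[z.1 - z0.1, z.1 - z0.1] <= 0 /\ '[z.2 - z0.2, z.2 - z0.2] <= 0.
    have := mulr_ge0 (ltW b0) h2; have := mulr_ge0 (ltW a0) h1.
    by split; [rewrite -(pmulr_rle0 _ a0)|rewrite -(pmulr_rle0 _ b0)]; lra.
  move/inner_eq0/eqP : e1; move/inner_eq0/eqP : e2; rewrite !subr_eq0.
  by move=> /eqP e2 /eqP e1; rewrite (surjective_pairing z) e1 e2 -surjective_pairing.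
exists z0 => //; split => w; apply: cvg_ultraP => U UU oU;
  have [z [Wz xz uz]] := ultra_lim U UU oU;
  rewrite -(uniq U z UU oU Wz xz uz); [exact: xz|exact: uz].
Qed.

End opial.

(** * Descent inequalities *)

Section scalar_inequalities.
Context {R : realType}.

(** The form sx r^2 + su s^2 - 2 l r s is positive definite since its
    determinant su sx - l^2 is positive; e is the quotient of this determinant
    by the trace, a lower bound of the smallest eigenvalue. *)
Lemma coercive_quadratic (sx su l : R) : 0 < sx -> 0 < su -> l ^+ 2 < su * sx ->
  exists2 e, 0 < e & forall r s, e * (r ^+ 2 + s ^+ 2) <=
    sx * r ^+ 2 + su * s ^+ 2 - 2 * l * r * s.
Proof.
move=> sx0 su0 l2; have S0 : 0 < sx + su by rewrite addr_gt0.
(* e (sx + su) is the determinant; (sx - e) times the difference of the two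
   sides is then a sum of two nonnegative terms *)
pose e := (su * sx - l ^+ 2) / (sx + su).
have eE : e * (sx + su) = su * sx - l ^+ 2 by rewrite /e divfK// gt_eqF.
have e0 : 0 < e by rewrite divr_gt0// subr_gt0.
exists e => // r s; rewrite -subr_ge0.
have ex : 0 < sx - e.
  rewrite -(pmulr_lgt0 _ S0) mulrBl eE; have := sqr_ge0 l; nra.
rewrite -(pmulr_rge0 _ ex).
have -> : (sx - e) * (sx * r ^+ 2 + su * s ^+ 2 - 2 * l * r * s -
     e * (r ^+ 2 + s ^+ 2)) = ((sx - e) * r - l * s) ^+ 2 +
     (su * sx - e * (sx + su) - l ^+ 2 + e ^+ 2) * s ^+ 2 by ring.
rewrite eE addr_ge0 ?sqr_ge0// mulr_ge0 ?sqr_ge0//; have := sqr_ge0 e; lra.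
Qed.

Lemma descent (E g : nat -> R) :
  (forall k, 0 <= E k) -> (forall k, 0 <= g k) ->
  (forall k, E k.+1 + g k <= E k) ->
  [/\ cvgn E, g @ \oo --> 0 & forall n, \sum_(k < n) g k <= E 0%N].
Proof.
move=> E0 g0 Eg.
have Ec : cvgn E.
  apply: nonincreasing_is_cvgn.
    apply: (@homo_leq _ _ (fun a b : R => b <= a)) => //.
      by move=> a b c ba cb; exact: le_trans cb ba.
    by move=> k; apply: le_trans (Eg k); rewrite lerDl.
  by exists 0 => _ [k _ <-].
split => //.
- apply: (@squeeze_cvgr _ _ _ _ (fun=> 0) (fun k => E k - E k.+1)).
  + by near=> k; rewrite g0/= lerBrDr addrC.
  + exact: cvg_cst.
  + rewrite -(subrr (limn E)); apply: cvgB => //.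
    by rewrite -(cvg_shiftS E) in Ec *.
- suff h n : \sum_(k < n) g k + E n <= E 0%N.
    by move=> n; apply: le_trans (h n); rewrite lerDl.
  elim: n => [|n ih]; first by rewrite big_ord0 add0r.
  by rewrite big_ord_recr /=; have := Eg n; lra.
Unshelve. all: by end_near. Qed.

End scalar_inequalities.

Lemma sqnorm_cvg0 {R : realType} {V : normedModType R} (c : R) (g : nat -> R)
    (y : nat -> V) : 0 < c -> g @ \oo --> 0 ->
  (forall k, c * `|y k| ^+ 2 <= g k) -> y @ \oo --> 0.
Proof.
move=> c0 /cvgr0Pnorm_lt g0 yg; apply/cvgr0Pnorm_lt => eps eps0.
have ce : 0 < c * eps ^+ 2 by rewrite mulr_gt0 ?exprn_gt0.
near=> k; rewrite -(ltr_pXn2r (n:=2)) ?nnegrE// ?ltW// -(ltr_pM2l c0).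
by apply: le_lt_trans (yg k) _; apply: le_lt_trans (ler_norm _) _; near: k; exact: g0.
Unshelve. all: by end_near. Qed.

(** Used with y the forward term C x_k: what the energy controls is not the
    distance from y_k to its limit but its defect y_k - a - c v_k, where v_k
    tends to 0. *)
Lemma cvg_of_shifted {R : realType} {V : normedModType R} (c : R)
    (y v : nat -> V) (a : V) :
  (fun k => y k - a - c *: v k) @ \oo --> 0 -> v @ \oo --> 0 -> y @ \oo --> a.
Proof.
move=> h v0; have := cvgD h (cvgZl_tmp (k := c) v0).
rewrite scaler0 addr0 => {}h; apply/subr_cvg0.
rewrite (_ : (fun k => y k - a) = fun k => y k - a - c *: v k + c *: v k);
  first exact: h.
by apply/funext => k; rewrite subrK.
Qed.

(** * One step of the energy estimate *)

Section energy.
Context {R : realType} {H G : hilbertType R}.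
Variables (ti gi mi di sx su : R).

(** Here X = x - xh and U = u - uh are the deviations from a solution, q is the
    previous primal increment and Lq its image by L. The cross term is what the
    extrapolation leaves of the coupling between the primal and the dual steps. *)
Definition energy (X q : H) (U Lq : G) : R :=
  ti * '[X, X] + gi * '[U, U] - 2 * '[U, Lq] + sx * '[q, q].

(** The sum of the monotonicity inequalities hA and hB at the two resolvent
    steps, of the cocoercivity inequalities and of the decrease of the distance
    under the activated operator. The coupling terms <U, L q> telescope because
    the extrapolation makes the dual step see L (X - q), and the cocoercivity
    inequalities are used in completed squares, whose defects stay in the
    decrement. LP, LX and Lq stand for the images by L of P, X and q. *)
Lemma energy_step (mu delta kappa : R) (X P q c X' PX' : H) (U U' e LX LP Lq : G) :
  0 < mu -> 0 < delta -> mi = (2 * mu)^-1 -> di = (2 * delta)^-1 ->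
  sx = ti - mi -> su = gi - di -> 0 <= ti ->
  0 <= '[P, ti *: (X - P) - c] - '[LP, U'] ->
  0 <= '[U', gi *: (U - U') + (LX - Lq - e)] ->
  mu * '[c, c] <= '[X, c] -> delta * '[e, e] <= '[U, e] ->
  '[X', X'] + kappa * '[PX', PX'] <= '[P, P] ->
  energy X' (X - P) U' (LX - LP) +
  (ti * kappa * '[PX', PX'] +
   2 * mu * '[c - mi *: (X - P), c - mi *: (X - P)] +
   2 * delta * '[e - di *: (U - U'), e - di *: (U - U')] +
   (sx * '[q, q] + su * '[U' - U, U' - U] + 2 * '[U' - U, Lq]))
  <= energy X q U Lq.
Proof.
move=> mu0 delta0 mE dE sxE suE ti0 hA hB hc he hT.
have sq (V : hilbertType R) (r ri : R) (a b : V) : 0 < r -> ri = (2 * r)^-1 ->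
    2 * r * '[a - ri *: b, a - ri *: b] =
    2 * r * '[a, a] - 2 * '[a, b] + ri * '[b, b].
  move=> r0 ->; rewrite !innerE (innerC b a); field; exact: lt0r_neq0.
(* the monotonicity inequalities count twice, the distances carry the weight ti *)
have {}hT := ler_wpM2l ti0 hT.
rewrite (sq _ mu)// (sq _ delta)// /energy sxE suE.
move: hA hB hc he hT; clear.
rewrite !innerE (innerC P X) (innerC LP U') (innerC U' U).
rewrite (innerC c P) (innerC c X) (innerC e U) (innerC e U').
lra.
Qed.

End energy.

(** Pass to the limit in the cocoercivity inequality between x_k and l: the
    right-hand side pairs a weakly null sequence with a strongly convergent one. *)
Lemma cocoercive_demiclosed {R : realType} {V : hilbertType R} (F : set_system nat)
    {FF : ProperFilter F} (rho M : R) (N : V -> V) (x : nat -> V) (l c : V) :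
  0 < rho ->
  (forall y z, rho * '[N y - N z, N y - N z] <= '[y - z, N y - N z]) ->
  (\forall k \near F, `|x k| <= M) -> weak_cvg F x l ->
  (fun k => N (x k)) @ F --> c -> N l = c.
Proof.
move=> rho0 NP xM xl Nc.
have dN : (fun k => N (x k) - N l) @ F --> c - N l.
  by apply: cvgB => //; exact: cvg_cst.
have h1 : (fun k => '[x k - l, N (x k) - N l]) @ F --> '[0 : V, c - N l].
  apply: (@weak_cvg_inner _ _ _ _ _ (M + `|l|)) => //.
    near=> k; apply: le_trans (ler_normB _ _) _; rewrite lerD2r.
    by near: k.
  by rewrite -(subrr l); apply: weak_cvgD => //; apply: cvg_weak; exact: cvg_cst.
have h2 : (fun k => rho * '[N (x k) - N l, N (x k) - N l]) @ F -->
    rho * '[c - N l, c - N l] by apply: cvgMl_tmp; exact: cvg_inner.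
have : rho * '[c - N l, c - N l] - '[0 : V, c - N l] <= 0.
  apply: cvgr_to_le (cvgB h2 h1) _.
  by near=> k; rewrite /= subr_le0.
rewrite inner0l subr0 pmulr_rle0// => /inner_eq0/eqP.
by rewrite subr_eq0 => /eqP.
Unshelve. all: by end_near. Qed.

(** Either (x, a) is monotonically related to A, in which case it belongs to A
    and testing with it leaves the second inequality alone; or some point of A
    makes the first term negative, so that (w, b) belongs to B, and testing with
    it contradicts the sign of the first term. *)
Lemma product_monotonically_complete {R : realType} {H G : hilbertType R}
    (A : H -> set H) (B : G -> set G) x a w b :
  monotonically_complete A -> monotonically_complete B ->
  (forall y a' v b', A y a' -> B v b' -> 0 <= '[x - y, a - a'] + '[w - v, b - b']) ->
  A x a /\ B w b.
Proof.
move=> cA cB h.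
have [hA|] := pselect (forall y a', A y a' -> 0 <= '[x - y, a - a']).
  have Ax := cA _ _ hA; split => //; apply: cB => v b' Bv.
  by have := h _ _ _ _ Ax Bv; rewrite subrr inner0l add0r.
move=> /existsNP[y /existsNP[a' /not_implyP[Ay /negP]]]; rewrite -ltNge => lt.
have Bw : B w b by apply: cB => v b' Bv; have := h _ _ _ _ Ay Bv; lra.
by have := h _ _ _ _ Ay Bw; rewrite subrr inner0l; lra.
Qed.

(** * Analysis of one path of the algorithm *)

Section primal_dual_path.
Context {R : realType} {H G : hilbertType R}.
Variables (A : H -> set H) (B D : G -> set G) (C : H -> H) (L : {linear H -> G}).
Variables (delta mu tau gamma : R).
Hypotheses (maxA : maximally_monotone A) (maxB : maximally_monotone B)
  (maxD : maximally_monotone D) (delta_gt0 : 0 < delta)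
  (strD : strongly_monotone delta D)
  (mu_gt0 : 0 < mu) (cocC : cocoercive mu (single_valued C))
  (bndL : bounded_near L (nbhs (0 : H)))
  (tauP : 0 < tau < 2 * mu) (gammaP : 0 < gamma < 2 * delta)
  (Lbnd : opnorm L ^+ 2 <
    (gamma^-1 - (2 * delta)^-1) * (tau^-1 - (2 * mu)^-1)).

Let Di := value (inverse D).
Let Z0 := primal_dual_solutions A B D C L.
Let sx := tau^-1 - (2 * mu)^-1.
Let su := gamma^-1 - (2 * delta)^-1.

Let DiP w : D (Di w) w.
Proof. exact: inverse_inclusion delta_gt0 strD (maximally_monotone_complete maxD). Qed.

Let Di_uniq d w : D d w -> d = Di w.
Proof.
move=> Dd; have := strD Dd (DiP w); rewrite subrr inner0r pmulr_rle0// => h.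
by apply/eqP; rewrite -subr_eq0; apply/eqP/inner_eq0; rewrite -norm_inner.
Qed.

Lemma cocoercive_single y z : mu * '[C y - C z, C y - C z] <= '[y - z, C y - C z].
Proof. by rewrite -norm_inner innerC; exact: cocC. Qed.

Lemma cocoercive_inverse v w : delta * '[Di v - Di w, Di v - Di w] <= '[v - w, Di v - Di w].
Proof. by rewrite -norm_inner innerC; exact: strD. Qed.

(** Strong monotonicity makes the inverse of D single-valued, so the inclusions
    can be written with its value. *)
Lemma primal_dual_solutionsP z :
  Z0 z <-> A z.1 (- (adjoint L z.2 + C z.1)) /\ B (L z.1 - Di z.2) z.2.
Proof.
split => [[[a Aa /eqP ea] [b Bb [d Dd /eqP eb]]]|[Az Bz]].
  move: ea eb; rewrite -addrA addr_eq0 => /eqP ea.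
  rewrite addr_eq0 subr_eq => /eqP eb.
  by rewrite -ea -(Di_uniq Dd) addrC -eb.
split; first by exists (- (adjoint L z.2 + C z.1)) => //; rewrite -addrA addNr.
exists (L z.1 - Di z.2) => //; exists (Di z.2); first exact: DiP.
by rewrite addrAC subrK subrr.
Qed.

(* xS holds for the identity and for every averaged operator that fixes S
   pointwise, if kappa is at most (1 - alpha) / alpha *)
Variables (S : set H) (kappa : R) (x xbar p : nat -> H) (u : nat -> G).
Hypotheses (kappa_gt0 : 0 < kappa) (xbar0 : xbar 0%N = x 0%N)
  (uS : forall k, u k.+1 = value (resolvent (scale_op gamma (inverse B)))
      (u k + gamma *: (L (xbar k) - Di (u k))))
  (pS : forall k, p k.+1 = value (resolvent (scale_op tau A))
      (x k - tau *: (adjoint L (u k.+1) + C (x k))))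
  (xS : forall k xh, S xh -> `|x k.+1 - xh| ^+ 2 +
      kappa * `|p k.+1 - x k.+1| ^+ 2 <= `|p k.+1 - xh| ^+ 2)
  (xbarS : forall k, xbar k.+1 = x k.+1 + p k.+1 - x k).

Let q k := x k - xbar k.

Let qS k : q k.+1 = x k - p k.+1.
Proof. by rewrite /q xbarS; vector_eq. Qed.

Let tau0 : 0 < tau. Proof. by case/andP: tauP. Qed.
Let gamma0 : 0 < gamma. Proof. by case/andP: gammaP. Qed.

Let sx0 : 0 < sx.
Proof. by rewrite subr_gt0 ltf_pV2 ?posrE ?mulr_gt0//; case/andP: tauP. Qed.

Let su0 : 0 < su.
Proof. by rewrite subr_gt0 ltf_pV2 ?posrE ?mulr_gt0//; case/andP: gammaP. Qed.

Lemma primal_inclusion k :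
  A (p k.+1) (tau^-1 *: q k.+1 - adjoint L (u k.+1) - C (x k)).
Proof.
have := resolvent_inclusion (x k - tau *: (adjoint L (u k.+1) + C (x k))) tau0
  maxA.1 (maximally_monotone_complete maxA).
rewrite -pS qS; congr (A _ _).
by rewrite addrAC scalerBr scalerA mulVf ?gt_eqF// scale1r opprD addrA.
Qed.

Lemma dual_inclusion k :
  B (gamma^-1 *: (u k - u k.+1) + (L (x k) - L (q k) - Di (u k))) (u k.+1).
Proof.
have [mB cB] := inverse_monotone_complete maxB.1 (maximally_monotone_complete maxB).
have := resolvent_inclusion (u k + gamma *: (L (xbar k) - Di (u k))) gamma0 mB cB.
rewrite -uS /inverse; congr (B _ _).
rewrite -linearB (_ : x k - q k = xbar k); last by rewrite /q; vector_eq.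
by rewrite addrAC scalerDr scalerA mulVf ?gt_eqF// scale1r.
Qed.

Section energy_decrease.
Variable e : R.
Hypotheses (e0 : 0 < e) (eP : forall r s, e * (r ^+ 2 + s ^+ 2) <=
    sx * r ^+ 2 + su * s ^+ 2 - 2 * opnorm L * r * s).
Variable z : H * G.
Hypotheses (Sz : S z.1) (Zz : Z0 z).

Let E k := energy tau^-1 gamma^-1 sx (x k - z.1) (q k) (u k - z.2) (L (q k)).
(* the energy lost at step k; the last term is what remains of the quadratic form
   in q_k and in the dual increment *)
Let g k := tau^-1 * kappa * '[p k.+1 - x k.+1, p k.+1 - x k.+1] +
   2 * mu * '[C (x k) - C z.1 - (2 * mu)^-1 *: q k.+1,
              C (x k) - C z.1 - (2 * mu)^-1 *: q k.+1] +
   2 * delta * '[Di (u k) - Di z.2 - (2 * delta)^-1 *: (u k - u k.+1),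
                 Di (u k) - Di z.2 - (2 * delta)^-1 *: (u k - u k.+1)] +
   e * ('[q k, q k] + '[u k.+1 - u k, u k.+1 - u k]).

Let cross (v : G) (y : H) : `|'[v, L y]| <= opnorm L * `|y| * `|v|.
Proof.
apply: le_trans (cauchy_schwarz _ _) _.
by rewrite mulrC ler_wpM2r//; exact: opnormP.
Qed.

(** The cross term is absorbed by sx |q|^2 and by the part su |U|^2 of |U|^2 /
    gamma, through [coercive_quadratic]. *)
Lemma energy_ge k :
  tau^-1 * '[x k - z.1, x k - z.1] + e * '[u k - z.2, u k - z.2] <= E k.
Proof.
rewrite /E /energy; have := eP `|q k| `|u k - z.2|.
have := cross (u k - z.2) (q k); rewrite ler_norml => /andP[_].
rewrite !norm_inner.
have : 0 <= (2 * delta)^-1 * '[u k - z.2, u k - z.2].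
  by rewrite mulr_ge0 ?inner_ge0// invr_ge0 mulr_ge0// ltW.
have : 0 <= e * '[q k, q k] by rewrite mulr_ge0 ?inner_ge0// ltW.
rewrite /su; lra.
Qed.

Lemma energy_decrease k : E k.+1 + g k <= E k.
Proof.
have [Az Bz] := (primal_dual_solutionsP z).1 Zz.
have ti0 : 0 <= tau^-1 by rewrite invr_ge0 ltW.
have hA : 0 <= '[p k.+1 - z.1, tau^-1 *: ((x k - z.1) - (p k.+1 - z.1))
      - (C (x k) - C z.1)] - '[L (p k.+1 - z.1), u k.+1 - z.2].
  rewrite (adjointP bndL) (adjointB bndL).
  have := monotoneP maxA.1 (primal_inclusion k) Az.
  by rewrite qS !innerE; lra.
have hB : 0 <= '[u k.+1 - z.2, gamma^-1 *: ((u k - z.2) - (u k.+1 - z.2)) +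
    (L (x k - z.1) - L (q k) - (Di (u k) - Di z.2))].
  rewrite innerC (linearB L).
  rewrite (_ : gamma^-1 *: _ + _ = gamma^-1 *: (u k - u k.+1) +
    (L (x k) - L (q k) - Di (u k)) - (L z.1 - Di z.2)); last by vector_eq.
  exact: monotoneP maxB.1 (dual_inclusion k) Bz.
have hT := xS k Sz; rewrite !norm_inner in hT.
have hC := cocoercive_single (x k) z.1.
have hD := cocoercive_inverse (u k) z.2.
have := energy_step (q k) mu_gt0 delta_gt0 erefl erefl erefl erefl ti0 hA hB
  (cocoercive_single (x k) z.1) (cocoercive_inverse (u k) z.2) hT.
have qE : x k - z.1 - (p k.+1 - z.1) = q k.+1 by rewrite qS; vector_eq.
have uE : u k - z.2 - (u k.+1 - z.2) = u k - u k.+1 by vector_eq.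
have uE' : u k.+1 - z.2 - (u k - z.2) = u k.+1 - u k by vector_eq.
rewrite -linearB qE uE uE'; apply: le_trans; rewrite lerD2l /g lerD2l.
have := eP `|q k| `|u k.+1 - u k|.
have := cross (u k.+1 - u k) (q k); rewrite ler_norml => /andP[+ _].
by rewrite !norm_inner -/sx -/su; lra.
Qed.

Let g_parts k : [/\ tau^-1 * kappa * `|p k.+1 - x k.+1| ^+ 2 <= g k,
  2 * mu * `|C (x k) - C z.1 - (2 * mu)^-1 *: q k.+1| ^+ 2 <= g k,
  2 * delta * `|Di (u k) - Di z.2 - (2 * delta)^-1 *: (u k - u k.+1)| ^+ 2 <= g k,
  e * `|q k| ^+ 2 <= g k & e * `|u k.+1 - u k| ^+ 2 <= g k] /\ 0 <= g k.
Proof.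
rewrite !norm_inner /g.
have mul_ge0 c (V : hilbertType R) (v : V) : 0 < c -> 0 <= c * '[v, v].
  by move=> c0; rewrite mulr_ge0 ?inner_ge0// ltW.
set v1 := p k.+1 - _; set v2 := C (x k) - _ - _; set v3 := Di (u k) - _ - _.
set v5 := u k.+1 - u k.
have h1 : 0 <= tau^-1 * kappa * '[v1, v1].
  by apply: mul_ge0; rewrite mulr_gt0// invr_gt0.
have h2 : 0 <= 2 * mu * '[v2, v2] by apply: mul_ge0; rewrite mulr_gt0.
have h3 : 0 <= 2 * delta * '[v3, v3] by apply: mul_ge0; rewrite mulr_gt0.
have h4 := mul_ge0 _ _ (q k) e0.
have h5 := mul_ge0 _ _ v5 e0.
by split; first split; lra.
Qed.

Let energy_ge0 k : 0 <= E k.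
Proof.
apply: le_trans (energy_ge k).
by rewrite addr_ge0// mulr_ge0 ?inner_ge0// ?invr_ge0 ltW.
Qed.

Let energy_descent := descent energy_ge0 (fun k => (g_parts k).2) energy_decrease.

Let g_cvg0 : g @ \oo --> 0. Proof. by case: energy_descent. Qed.

Lemma extrapolation_cvg0 : q @ \oo --> 0.
Proof. by apply: sqnorm_cvg0 e0 g_cvg0 _ => k; case: (g_parts k) => -[]. Qed.

Lemma dual_increment_cvg0 : (fun k => u k.+1 - u k) @ \oo --> 0.
Proof. by apply: sqnorm_cvg0 e0 g_cvg0 _ => k; case: (g_parts k) => -[]. Qed.

Lemma activation_increment_cvg0 : (fun k => p k.+1 - x k.+1) @ \oo --> 0.
Proof.
have c0 : 0 < tau^-1 * kappa by rewrite mulr_gt0// invr_gt0.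
by apply: sqnorm_cvg0 c0 g_cvg0 _ => k; case: (g_parts k) => -[].
Qed.

Lemma extrapolation_shift_cvg0 : (fun k => q k.+1) @ \oo --> 0.
Proof. by have := extrapolation_cvg0; rewrite -cvg_shiftS. Qed.

Lemma primal_forward_cvg : (fun k => C (x k)) @ \oo --> C z.1.
Proof.
have c0 : 0 < 2 * mu by rewrite mulr_gt0.
have h : (fun k => C (x k) - C z.1 - (2 * mu)^-1 *: q k.+1) @ \oo --> 0.
  by apply: sqnorm_cvg0 c0 g_cvg0 _ => k; case: (g_parts k) => -[].
exact: cvg_of_shifted h extrapolation_shift_cvg0.
Qed.

Lemma dual_forward_cvg : (fun k => Di (u k)) @ \oo --> Di z.2.
Proof.
have c0 : 0 < 2 * delta by rewrite mulr_gt0.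
have h : (fun k => Di (u k) - Di z.2 - (2 * delta)^-1 *: (u k - u k.+1)) @ \oo --> 0.
  by apply: sqnorm_cvg0 c0 g_cvg0 _ => k; case: (g_parts k) => -[].
apply: cvg_of_shifted h _; rewrite -oppr0; have h' := cvgN dual_increment_cvg0.
rewrite (_ : (fun k => u k - u k.+1) = - (fun k => u k.+1 - u k));
  first exact: h'.
by apply/funext => k; rewrite fctE opprB.
Qed.

Lemma iterates_bounded : exists M, forall k, `|x k| <= M /\ `|u k| <= M.
Proof.
have Em k : E k <= E 0%N.
  elim: k => // k; apply: le_trans.
  by apply: le_trans (energy_decrease k); rewrite lerDl (g_parts k).2.
have bnd (V : hilbertType R) (c : R) (v w : V) : 0 < c ->
    c * '[v - w, v - w] <= E 0%N -> `|v| <= `|w| + (1 + E 0%N / c).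
  move=> c0 h; rewrite -lerBlDl; apply: le_trans (lerB_dist _ _) _.
  rewrite -norm_inner mulrC -ler_pdivlMr// in h.
  have := sqr_ge0 (`|v - w| - 1); have := sqr_ge0 `|v - w|; nra.
have ti0 : 0 < tau^-1 by rewrite invr_gt0.
exists (Num.max (`|z.1| + (1 + E 0%N / tau^-1)) (`|z.2| + (1 + E 0%N / e))).
move=> k; have := le_trans (energy_ge k) (Em k) => h.
rewrite !le_max; split.
  rewrite bnd//; have := mulr_ge0 (ltW e0) (inner_ge0 (u k - z.2)); lra.
rewrite (bnd _ e)// ?orbT//.
have := mulr_ge0 (ltW ti0) (inner_ge0 (x k - z.1)); lra.
Qed.

Lemma distance_cvg : cvgn (fun k =>
  tau^-1 * `|x k - z.1| ^+ 2 + gamma^-1 * `|u k - z.2| ^+ 2).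
Proof.
have [Ec _ _] := energy_descent; have [M Mb] := iterates_bounded.
have Lq : (fun k => L (q k)) @ \oo --> (0 : G).
  rewrite -(linear0 L); apply: cvg_comp extrapolation_cvg0 _.
  exact: bounded_linear_continuous.
(* the energy differs from the weighted distance by two terms that tend to 0 *)
have cr : (fun k => '[u k - z.2, L (q k)]) @ \oo --> 0.
  apply: (@squeeze_cvgr _ _ _ _ (fun k => - ((M + `|z.2|) * `|L (q k)|))
     (fun k => (M + `|z.2|) * `|L (q k)|)).
  - near=> k; rewrite -ler_norml; apply: le_trans (cauchy_schwarz _ _) _.
    rewrite ler_wpM2r//; apply: le_trans (ler_normB _ _) _.
    by rewrite lerD2r (Mb k).2.
  - rewrite -oppr0 -[X in _ --> - X](mulr0 (M + `|z.2|)).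
    by apply: cvgN; apply: cvgMl_tmp; apply/norm_cvg0P.
  - by rewrite -[X in _ --> X](mulr0 (M + `|z.2|)); apply: cvgMl_tmp; apply/norm_cvg0P.
have qq : (fun k => '[q k, q k]) @ \oo --> 0.
  by rewrite -(@inner0r R H 0); apply: cvg_inner; exact: extrapolation_cvg0.
have h := cvgB (cvgD Ec (cvgMl_tmp (a := 2) cr)) (cvgMl_tmp (a := sx) qq).
apply/cvg_ex; eexists; rewrite (_ : (fun k => _) = (fun k =>
  E k + 2 * '[u k - z.2, L (q k)] - sx * '[q k, q k])); first exact: h.
by apply/funext => k; rewrite !norm_inner /E /energy; lra.
Unshelve. all: by end_near. Qed.

Lemma activation_increment_partial_sum_le n :
  \sum_(k < n) `|p k.+1 - x k.+1| ^+ 2 <=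
  (tau^-1 * `|x 0%N - z.1| ^+ 2 + gamma^-1 * `|u 0%N - z.2| ^+ 2) /
  (tau^-1 * kappa).
Proof.
have c0 : 0 < tau^-1 * kappa by rewrite mulr_gt0// invr_gt0.
have [_ _ /(_ n) h] := energy_descent.
rewrite ler_pdivlMr// mulr_suml !norm_inner.
have -> : tau^-1 * '[x 0%N - z.1, x 0%N - z.1] +
    gamma^-1 * '[u 0%N - z.2, u 0%N - z.2] = E 0%N.
  by rewrite /E /energy /q xbar0 subrr linear0 !inner0r; lra.
apply: le_trans h; apply: ler_sum => k _.
by rewrite mulrC; case: (g_parts k) => -[].
Qed.

End energy_decrease.

Let energy_modulus := coercive_quadratic sx0 su0 Lbnd.

Lemma resolvents_weak_cluster (z : H * G) (Sz : S z.1) (Zz : Z0 z)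
    {F : set_system nat} {FF : ProperFilter F} (l : H) :
  \oo `<=` F -> weak_cvg F x l -> weak_cvg F (fun k => p k.+1) l.
Proof.
move=> oF xl; apply: weak_cvg_shift xl _.
have [e e0 eP] := energy_modulus.
have h2 := extrapolation_shift_cvg0 e0 eP Sz Zz.
rewrite (_ : (fun k => p k.+1 - x k) = - (fun k => q k.+1)); last first.
  by apply/funext => k; rewrite fctE qS opprB.
by rewrite -oppr0; apply: cvgN; apply: cvg_trans h2 => S' /oF.
Qed.

(** C x_k and the inverse of D at u_k converge strongly, and by demiclosedness
    their limits are the values at the cluster point. In the sum of the two
    monotonicity inequalities the products of weakly convergent sequences
    <u_(k+1), L p_(k+1)> and <u_(k+1), L x_k> combine into <u_(k+1), L q_(k+1)>,
    which tends to 0, so the sum passes to the limit, and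
    [product_monotonically_complete] applies. *)
Lemma weak_cluster_solution (z : H * G) (F : set_system nat) {FF : ProperFilter F}
    (l : H * G) : S z.1 -> Z0 z -> \oo `<=` F ->
  weak_cvg F x l.1 -> weak_cvg F u l.2 -> Z0 l.
Proof.
move=> Sz Zz oF xl ul; have [e e0 eP] := energy_modulus.
have toF (X : topologicalType) (y : nat -> X) (b : X) : y @ \oo --> b -> y @ F --> b.
  by move=> h; apply: cvg_trans h => S' /oF.
have [M Mb] := iterates_bounded e0 eP Sz Zz.
have q0 := toF _ _ _ (extrapolation_cvg0 e0 eP Sz Zz).
have q0' := toF _ _ _ (extrapolation_shift_cvg0 e0 eP Sz Zz).
have du0 := dual_increment_cvg0 e0 eP Sz Zz.
have Cc := toF _ _ _ (primal_forward_cvg e0 eP Sz Zz).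
have Dc := toF _ _ _ (dual_forward_cvg e0 eP Sz Zz).
have Cl : C l.1 = C z.1.
  apply: (cocoercive_demiclosed (M := M) mu_gt0 cocoercive_single _ xl Cc).
  by near=> k; exact: (Mb k).1.
have Dl : Di l.2 = Di z.2.
  apply: (cocoercive_demiclosed (M := M) delta_gt0 cocoercive_inverse _ ul Dc).
  by near=> k; exact: (Mb k).2.
have pl : weak_cvg F (fun k => p k.+1) l.1.
  exact: (resolvents_weak_cluster Sz Zz oF xl).
have ul' : weak_cvg F (fun k => u k.+1) l.2 by exact: weak_cvg_shift ul (toF _ _ _ du0).
apply/primal_dual_solutionsP; apply: (@product_monotonically_complete _ _ _ A
  (fun v => [set b | B b v]) l.1 (- (adjoint L l.2 + C l.1)) l.2 (L l.1 - Di l.2)).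
- exact: maximally_monotone_complete maxA.
- by have [] := inverse_monotone_complete maxB.1 (maximally_monotone_complete maxB).
move=> y a v b Ay Bv.
(* the monotonicity inequalities at (y, a) and (v, b), with the bilinear terms
   rearranged so that each summand pairs a weakly convergent sequence with a
   strongly convergent or a constant one *)
have step k : 0 <= '[p k.+1 - y, tau^-1 *: q k.+1 - C (x k) - a]
    + '[u k.+1, L y] + '[u k.+1, L (q k.+1)]
    + '[u k.+1 - v, gamma^-1 *: (u k - u k.+1) - L (q k) - Di (u k) - b]
    - '[v, L (x k)].
  have := monotoneP maxA.1 (primal_inclusion k) Ay.
  have := monotoneP maxB.1 (dual_inclusion k) Bv; rewrite innerC.
  have := adjointP bndL (u k.+1) (p k.+1); have := adjointP bndL (u k.+1) y.
  rewrite !(innerC (L _) (u k.+1)) qS (linearB L) !innerE.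
  lra.
have Lc (w : nat -> H) : w @ F --> 0 -> (fun k => L (w k)) @ F --> (0 : G).
  move=> w0; rewrite -(linear0 L); apply: cvg_comp w0 _.
  exact: bounded_linear_continuous.
have t1 : (fun k => '[p k.+1 - y, tau^-1 *: q k.+1 - C (x k) - a]) @ F -->
    '[l.1 - y, tau^-1 *: 0 - C z.1 - a].
  apply: (@weak_cvg_inner _ _ _ _ _ (M + 1 + `|y|)).
  - near=> k; apply: le_trans (ler_normB _ _) _; rewrite lerD2r.
    rewrite (_ : p k.+1 = x k - q k.+1); last by rewrite qS; vector_eq.
    apply: le_trans (ler_normB _ _) _; apply: lerD; first exact: (Mb k).1.
    by near: k; move/cvgr0Pnorm_le : q0'; apply.
  - by apply: weak_cvgD => //; apply: cvg_weak; exact: cvg_cst.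
  - apply: cvgB; last exact: cvg_cst.
    by apply: cvgB => //; exact: cvgZl_tmp.
have t3 : (fun k => '[u k.+1, L (q k.+1)]) @ F --> '[l.2, 0 : G].
  apply: (@weak_cvg_inner _ _ _ _ _ M) => //; last exact: Lc.
  by near=> k; exact: (Mb k.+1).2.
have t4 : (fun k => '[u k.+1 - v, gamma^-1 *: (u k - u k.+1) - L (q k) - Di (u k) - b])
    @ F --> '[l.2 - v, gamma^-1 *: - 0 - 0 - Di z.2 - b].
  apply: (@weak_cvg_inner _ _ _ _ _ (M + `|v|)).
  - by near=> k; apply: le_trans (ler_normB _ _) _; rewrite lerD2r (Mb k.+1).2.
  - by apply: weak_cvgD => //; apply: cvg_weak; exact: cvg_cst.
  - apply: cvgB; last exact: cvg_cst.
    apply: cvgB => //; apply: cvgB; last exact: Lc.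
    apply: cvgZl_tmp; rewrite (_ : (fun k => u k - u k.+1) =
        - (fun k => u k.+1 - u k)); last by apply/funext => k; rewrite fctE opprB.
    by apply: cvgN; exact: toF.
have t5 : (fun k => '[v, L (x k)]) @ F --> '[v, L l.1].
  rewrite innerC (adjointP bndL); under eq_cvg do rewrite innerC (adjointP bndL).
  exact: xl.
have lim := cvgB (cvgD (cvgD (cvgD t1 (ul' (L y))) t3) t4) t5.
have : 0 <= '[l.1 - y, tau^-1 *: 0 - C z.1 - a] + '[l.2, L y] + '[l.2, 0 : G]
    + '[l.2 - v, gamma^-1 *: - 0 - 0 - Di z.2 - b] - '[v, L l.1].
  by apply: cvgr_to_ge (lim _ _ _ _) _; near=> k; exact: step.
rewrite -Cl -Dl oppr0 !scaler0.
have := adjointP bndL l.2 l.1; have := adjointP bndL l.2 y.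
rewrite (innerC (L y)) (innerC (L l.1)).
by rewrite !innerE !inner0r; lra.
Unshelve. all: by end_near. Qed.

Section known_solution.
Variable z : H * G.
Hypotheses (Sz : S z.1) (Zz : Z0 z).

Lemma activation_increment_summable n :
  \sum_(k < n) `|p k.+1 - x k.+1| ^+ 2 <=
  (tau^-1 * `|x 0%N - z.1| ^+ 2 + gamma^-1 * `|u 0%N - z.2| ^+ 2) /
  (tau^-1 * kappa).
Proof.
by have [e e0 eP] := energy_modulus; exact: (activation_increment_partial_sum_le e0 eP Sz Zz).
Qed.

(** p_(k+2) - p_(k+1) is - q_(k+2) minus the increment p_(k+1) - x_(k+1). *)
Lemma consecutive_resolvents_cvg0 : (fun k => p k.+2 - p k.+1) @ \oo --> 0.
Proof.
have [e e0 eP] := energy_modulus.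
have h1 := activation_increment_cvg0 e0 eP Sz Zz.
have h2 := extrapolation_shift_cvg0 e0 eP Sz Zz.
have h3 : (fun k => q k.+2) @ \oo --> 0 by move: h2; rewrite -cvg_shiftS.
have h := cvgN (cvgD h3 h1); rewrite addr0 oppr0 in h.
rewrite (_ : (fun k => _) = - ((fun k => q k.+2) + (fun k => p k.+1 - x k.+1))).
  exact: (h _ _).
by apply/funext => k; rewrite !fctE qS; vector_eq.
Qed.

Lemma resolvents_bounded : exists M, \forall k \near \oo, `|p k.+1| <= M.
Proof.
have [e e0 eP] := energy_modulus.
have [M Mb] := iterates_bounded e0 eP Sz Zz.
have h2 := extrapolation_shift_cvg0 e0 eP Sz Zz.
exists (M + 1); near=> k.
rewrite (_ : p k.+1 = x k - q k.+1); last by rewrite qS; vector_eq.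
apply: le_trans (ler_normB _ _) _; apply: lerD; first exact: (Mb k).1.
by near: k; move/cvgr0Pnorm_le : h2; apply.
Unshelve. all: by end_near. Qed.

Lemma iterates_weak_cvg :
  (forall F, ProperFilter F -> \oo `<=` F ->
     forall l, Z0 l -> weak_cvg F x l.1 -> S l.1) ->
  exists z', [/\ S z'.1, Z0 z', weak_cvg \oo x z'.1 & weak_cvg \oo u z'.2].
Proof.
move=> hS; have [e e0 eP] := energy_modulus.
have [M Mb] := iterates_bounded e0 eP Sz Zz.
have ti0 : 0 < tau^-1 by rewrite invr_gt0.
have gi0 : 0 < gamma^-1 by rewrite invr_gt0.
have [|||z' [Sz' Zz'] [xz' uz']] := @opial R H G x u tau^-1 gamma^-1 M
    [set z' | S z'.1 /\ Z0 z'] ti0 gi0 (fun k => (Mb k).1) (fun k => (Mb k).2).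
- by exists z.
- by move=> z' [Sz' Zz']; exact: (distance_cvg e0 eP Sz' Zz').
- move=> F PF oF l xl ul.
  have Zl : Z0 l by exact: (weak_cluster_solution Sz Zz oF xl ul).
  by split => //; exact: (hS F).
by exists z'.
Qed.

End known_solution.
End primal_dual_path.

(** * Functions of the past and conditional summability *)

Section history.
Context {d : measure_display} {Omega : measurableType d} {R : realType}.
Variables (P : probability Omega R) (m : nat) (eps : nat -> {RV P >-> 'I_m.+1}).
Hypothesis indep : Defs.independent P eps.

(** The activations are indexed from 1, as the algorithm selects T_i with i =
    eps_(k+1) at step k. Functions of this kind take finitely many values, each
    on a union of cylinders, hence are measurable. *)
Definition history_determined {T : Type} k (f : Omega -> T) := forall w w',
  (forall j, (j < k)%N -> eps j.+1 w = eps j.+1 w') -> f w = f w'.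

Let hist k w : k.-tuple 'I_m.+1 := [tuple eps j.+1 w | j < k].
Let cyl k (s : k.-tuple 'I_m.+1) : set Omega := [set w | hist k w = s].

Let cylE k (s : k.-tuple 'I_m.+1) : cyl s =
  \bigcap_(n in [set` iota 1 k]) eps n @^-1` [set nth ord0 s n.-1].
Proof.
apply/seteqP; split => w.
  rewrite /cyl /= => <- [|n] /=; rewrite mem_iota//=.
  rewrite add1n ltnS => nk.
  by have := tnth_nth ord0 (hist k w) (Ordinal nk); rewrite tnth_mktuple.
move=> h; apply: eq_from_tnth => j; rewrite tnth_mktuple (tnth_nth ord0).
by apply: (h j.+1); rewrite /= mem_iota /= add1n ltnS ltn_ord.
Qed.

Let event_measurable n (Y : set 'I_m.+1) : measurable (eps n @^-1` Y).
Proof. by rewrite -[X in measurable X]setTI; exact: measurable_funP. Qed.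

Let cyl_measurable k (s : k.-tuple 'I_m.+1) : measurable (cyl s).
Proof.
rewrite cylE; apply: bigcap_measurableType => // n _; exact: event_measurable.
Qed.

(** The definition of independence, compared for the index sequences 1, ..., k
    and k + 1, 1, ..., k. *)
Let cyl_indep k (s : k.-tuple 'I_m.+1) i :
  (P (cyl s `&` eps k.+1 @^-1` [set i]) =
   P (eps k.+1 @^-1` [set i]) * P (cyl s))%E.
Proof.
(* the activation eps_n, n >= 1, is the entry of index n - 1 of the history *)
pose Y n := if n == k.+1 then [set i] else [set nth ord0 s n.-1].
have niota : k.+1 \notin iota 1 k by rewrite mem_iota add1n ltnn andbF.
have YE : {in iota 1 k, forall n, Y n = [set nth ord0 s n.-1]}.
  by move=> n nk; rewrite /Y; case: eqP => // e; rewrite e (negbTE niota) in nk.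
have cE : cyl s = \bigcap_(n in [set` iota 1 k]) eps n @^-1` Y n.
  by rewrite cylE; apply: eq_bigcapr => n /= nk; rewrite YE.
have mY n : measurable (Y n) by [].
have -> : cyl s `&` eps k.+1 @^-1` [set i] =
    \bigcap_(n in [set` k.+1 :: iota 1 k]) eps n @^-1` Y n.
  rewrite cE; apply/seteqP; split => [w [cw ew] n|w h].
    rewrite /= inE => /orP[/eqP->|nk]; last exact: cw.
    by rewrite /Y eqxx.
  split => [n nk|]; first by apply: h; rewrite /= inE; apply/orP; right.
  have /= := h k.+1; rewrite inE eqxx /Y eqxx => /(_ erefl).
  exact.
rewrite indep ?cons_uniq ?niota ?iota_uniq// big_cons cE indep ?iota_uniq//.
by rewrite /Y eqxx.
Qed.

Lemma history_determined_simple k (f : Omega -> R) :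
  history_determined k f -> (forall w, 0 <= f w) ->
  exists phi : k.-tuple 'I_m.+1 -> R, (forall s, 0 <= phi s) /\
    forall w, f w = \sum_s phi s * \1_(cyl s) w.
Proof.
move=> df f0.
have /choice[phi phiP] : forall s : k.-tuple 'I_m.+1, exists v : R,
    0 <= v /\ forall w, cyl s w -> f w = v.
  move=> s; have [[w sw]|] := pselect (exists w, cyl s w).
    exists (f w); split => // w' sw'; apply: df => j jk.
    have := congr1 (fun t => tnth t (Ordinal jk)) (etrans sw' (esym sw)).
    by rewrite !tnth_mktuple.
  by move=> h; exists 0; split => // w sw; case: h; exists w.
exists phi; split => [s|w]; first exact: (phiP s).1.
rewrite (bigD1 (hist k w))//= indicE mem_set// mulr1.
rewrite big1 ?addr0; first by rewrite ((phiP (hist k w)).2 w).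
move=> s sw; rewrite indicE memNset ?mulr0// => e.
by move: sw; rewrite -e eqxx.
Qed.

Lemma history_determined_preimage {T : Type} k (f : Omega -> T) (A : set T) :
  history_determined k f -> measurable (f @^-1` A).
Proof.
move=> df; pose D := [set s : k.-tuple 'I_m.+1 | exists2 w, cyl s w & A (f w)].
rewrite (_ : f @^-1` A = \bigcup_(s in D) cyl s).
  by apply: fin_bigcup_measurable; [exact: finite_finset|move=> s _].
apply/seteqP; split => [w Aw|w [s [w' sw' Aw'] sw]].
  by exists (hist k w) => //; exists w.
rewrite /= (df w w')// => j jk.
have := congr1 (fun t => tnth t (Ordinal jk)) (etrans sw (esym sw')).
by rewrite !tnth_mktuple.
Qed.

Lemma history_determined_measurable k (f : Omega -> R) :
  history_determined k f -> measurable_fun setT f.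
Proof.
by move=> df _ Y _; rewrite setTI; exact: history_determined_preimage df.
Qed.

Local Open Scope ereal_scope.

Let integral_simple k (phi : k.-tuple 'I_m.+1 -> R) (E : set Omega) :
  (forall s, (0 <= phi s)%R) -> measurable E ->
  \int[P]_w ((\sum_s phi s * \1_(cyl s) w) * \1_E w)%R%:E =
  \sum_s (phi s)%:E * P (cyl s `&` E).
Proof.
move=> phi0 mE.
have indicM (s : k.-tuple 'I_m.+1) w :
    (phi s * \1_(cyl s) w * \1_E w)%R = (phi s * \1_(cyl s `&` E) w)%R.
  by rewrite indicI mulrA.
under eq_integral => w _.
  rewrite mulr_suml -sumEFin; under eq_bigr do rewrite indicM EFinM.
  over.
rewrite /= ge0_integral_sum//=.
- apply: eq_bigr => s _; rewrite ge0_integralZl//=.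
  + by rewrite integral_indic ?setIT//; exact: measurableI.
  + by apply/measurable_EFinP/measurable_indic/measurableI.
  + by rewrite lee_fin.
- move=> s; apply: measurable_funeM.
  by apply/measurable_EFinP/measurable_indic/measurableI.
- by move=> s w _; rewrite -EFinM lee_fin mulr_ge0.
Qed.

(** Conditioning on the past: f is constant on each cylinder of length k, and
    cylinders of length k are independent of eps_(k+1). *)
Lemma history_determined_integral k (f : Omega -> R) i :
  history_determined k f -> (forall w, (0 <= f w)%R) ->
  \int[P]_w (f w * \1_(eps k.+1 @^-1` [set i]) w)%:E =
  P (eps k.+1 @^-1` [set i]) * \int[P]_w (f w)%:E.
Proof.
move=> df f0; have [phi [phi0 phiE]] := history_determined_simple df f0.
under eq_integral do rewrite phiE.
rewrite integral_simple//.
have -> : \int[P]_w (f w)%:E =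
    \int[P]_w ((\sum_s phi s * \1_(cyl s) w) * \1_setT w)%R%:E.
  by apply: eq_integral => w _; rewrite phiE indicT mulr1.
rewrite integral_simple// ge0_sume_distrr.
  by apply: eq_bigr => s _; rewrite cyl_indep setIT muleCA.
by move=> s _; rewrite mule_ge0// lee_fin.
Qed.

Local Close Scope ereal_scope.

Section conditional_summability.
Variables (f : nat -> 'I_m.+1 -> Omega -> R) (J : nat -> {set 'I_m.+1}) (K zeta : R).
Hypotheses (df : forall k i, history_determined k (f k i))
  (f0 : forall k i w, 0 <= f k i w) (zeta0 : 0 < zeta)
  (Jzeta : forall k i, i \in J k -> (zeta%:E <= P (eps k.+1 @^-1` [set i]))%E)
  (fK : forall w n, \sum_(k < n) f k (eps k.+1 w) w <= K).

Let g k w := \sum_(i in J k) f k i w.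

Let mf k i : measurable_fun setT (f k i).
Proof. exact: history_determined_measurable (@df k i). Qed.

Let mg k : measurable_fun setT (g k).
Proof.
rewrite (_ : g k = fun w => \sum_i (if i \in J k then f k i w else 0)).
  by apply: measurable_sum => i; case: (i \in J k).
by apply/funext => w; rewrite /g big_mkcond.
Qed.

Let selectedE k w : f k (eps k.+1 w) w =
  \sum_i f k i w * \1_(eps k.+1 @^-1` [set i]) w.
Proof.
rewrite (bigD1 (eps k.+1 w))//= indicE mem_set// mulr1 big1 ?addr0// => i ni.
by rewrite indicE memNset ?mulr0// => /= e; rewrite e eqxx in ni.
Qed.

Let mselected k : measurable_fun setT (fun w => f k (eps k.+1 w) w).
Proof.
under eq_fun do rewrite selectedE.
by apply: measurable_sum => i; apply: measurable_funM => //; exact: measurable_indic.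
Qed.

Let integral_selected k :
  (zeta%:E * \int[P]_w (g k w)%:E <= \int[P]_w (f k (eps k.+1 w) w)%:E)%E.
Proof.
under [leRHS]eq_integral do rewrite selectedE -sumEFin.
rewrite ge0_integral_sum//=; last 2 first.
- move=> i; apply/measurable_EFinP; apply: measurable_funM; first exact: mf.
  exact: measurable_indic.
- by move=> i w _; rewrite lee_fin mulr_ge0.
rewrite /g; under eq_integral do rewrite big_mkcond /= -sumEFin.
have mfi i : measurable_fun setT
    (fun w => (if i \in J k then f k i w else 0)%:E).
  by apply/measurable_EFinP; case: (i \in J k).
rewrite ge0_integral_sum//=; last by move=> i w _; rewrite lee_fin; case: ifP.
rewrite ge0_sume_distrr; last first.
  by move=> i _; apply: integral_ge0 => w _; rewrite lee_fin; case: ifP.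
apply: lee_sum => i _; rewrite history_determined_integral//.
case: (boolP (i \in J k)) => iJ.
  rewrite lee_wpmul2r//; last exact: Jzeta.
  by apply: integral_ge0 => w _; rewrite lee_fin.
rewrite integral0 mule0 mule_ge0//.
by apply: integral_ge0 => w _; rewrite lee_fin.
Qed.

(** If the selected terms f_k (eps_(k+1)) have bounded sums, then by
    independence of the past the expectation of the sum over k and over i in J_k
    of f_k(i) is at most K / zeta; so that sum is almost surely finite and its
    general term tends to 0. *)
Lemma conditionally_summable_cvg0 : {ae P, forall w, g ^~ w @ \oo --> 0}.
Proof.
have g0 k w : 0 <= g k w by apply: sumr_ge0.
have mge k : measurable_fun setT (fun w => (g k w)%:E) by exact/measurable_EFinP.
have gK n : (\sum_(0 <= k < n) \int[P]_w (g k w)%:E <= (K / zeta)%:E)%E.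
  rewrite mulrC EFinM -lee_pdivrMl ?invr_gt0// invrK.
  rewrite ge0_sume_distrr; last first.
    by move=> k _; apply: integral_ge0 => w _; rewrite lee_fin.
  apply: (@le_trans _ _ (\sum_(0 <= k < n) \int[P]_w (f k (eps k.+1 w) w)%:E)%E).
    by apply: lee_sum => k _; exact: integral_selected.
  rewrite -ge0_integral_sum//; last 2 first.
  - by move=> k; exact/measurable_EFinP.
  - by move=> k w _; rewrite lee_fin.
  have -> : K%:E = (\int[P]_w (cst K%:E) w)%E.
    rewrite integral_cst//. rewrite -[LHS]mule1; congr (_ * _)%E; exact: (esym (probability_setT P)).
  apply: ge0_le_integral => //.
  - by move=> w _; apply: sume_ge0 => k _; rewrite lee_fin.
  - by apply: emeasurable_sum => k; exact/measurable_EFinP.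
  - by move=> w _; rewrite /= sumEFin lee_fin big_mkord; exact: fK.
have int_fin : P.-integrable setT (fun w => \sum_(0 <= k <oo) (g k w)%:E)%E.
  apply/integrableP; split.
    by apply: ge0_emeasurable_sum => // k w _ _; rewrite lee_fin.
  under eq_integral => w _.
    rewrite gee0_abs; last by apply: nneseries_ge0 => k _ _; rewrite lee_fin.
    over.
  rewrite integral_nneseries//; last by move=> k w _; rewrite lee_fin.
  apply: (@le_lt_trans _ _ (K / zeta)%:E); last by rewrite ltry.
  apply: lime_le; first by apply: is_cvg_nneseries => k _ _;
    apply: integral_ge0 => w _; rewrite lee_fin.
  by near=> n; exact: gK.
apply: filterS (integrable_ae measurableT int_fin) => w /(_ Logic.I) fin.
apply: cvg_series_cvg_0; apply: nondecreasing_is_cvgn.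
  apply/nondecreasing_seqP => n; rewrite /series /= big_nat_recr//= lerDl.
  exact: g0.
exists (fine (\sum_(0 <= k <oo) (g k w)%:E)%E) => _ [n _ <-].
rewrite -lee_fin fineK// /series /= -sumEFin.
by apply: nneseries_lim_ge => k _ _; rewrite lee_fin.
Unshelve. all: by end_near. Qed.

End conditional_summability.
End history.

(** * Averaged operators activated at least once per window *)

(** r varies slowly and becomes small at the times of J, which occur in every
    window of length N: between n and the next such time, r moves by at most N
    steps of size e / (N + 1). *)
Lemma window_cvg0 {R : realType} (r d : nat -> R) (J : nat -> Prop) (N : nat) :
  (forall k, `|r k.+1 - r k| <= d k) -> d @ \oo --> 0 ->
  (forall n, exists k, (n <= k < n + N)%N /\ J k) ->
  (forall e, 0 < e -> \forall k \near \oo, J k -> `|r k| <= e) ->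
  r @ \oo --> 0.
Proof.
move=> rd /cvgr0Pnorm_le d0 JN rJ; apply/cvgr0Pnorm_le => e e0.
pose e' := e / N.+1%:R.
have e'0 : 0 < e' by rewrite divr_gt0// ltr0n.
have [n1 _ h1] := d0 _ e'0; have [n2 _ h2] := rJ _ e'0.
near=> n.
have n1n : (n1 <= n)%N by near: n; exact: nbhs_infty_ge.
have n2n : (n2 <= n)%N by near: n; exact: nbhs_infty_ge.
have [k [/andP[nk knN] Jk]] := JN n.
have drift j : `|r (n + j)%N - r n| <= j%:R * e'.
  elim: j => [|j ih]; first by rewrite addn0 subrr normr0 mul0r.
  rewrite addnS -natr1 mulrDl mul1r [leRHS]addrC.
  rewrite (_ : r _ - r n = (r (n + j).+1 - r (n + j)%N) + (r (n + j)%N - r n)).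
    apply: le_trans (ler_normD _ _) _; apply: lerD => //.
    apply: le_trans (rd _) _; apply: le_trans (ler_norm _) _; apply: h1 => /=.
    by rewrite (leq_trans n1n)// leq_addr.
  by rewrite addrA subrK.
have := drift (k - n)%N; rewrite subnKC// distrC => hk.
have rk : `|r k| <= e' by apply: h2 => //=; exact: leq_trans nk.
have : `|r n| <= (k - n)%:R * e' + e'.
  rewrite -[X in `|X|](subrK (r k)); apply: le_trans (ler_normD _ _) _.
  exact: lerD.
move/le_trans; apply.
have -> : e = N.+1%:R * e' by rewrite mulrC divfK// pnatr_eq0.
rewrite -{2}[e']mul1r -mulrDl natr1 ler_wpM2r ?(ltW e'0)// ler_nat ltnS.
by rewrite leq_subLR ltnW.
Unshelve. all: by end_near. Qed.

Section averaged_operators.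
Context {R : realType} {V : hilbertType R}.
Variables (alpha : R) (T : V -> V).
Hypotheses (alphaP : 0 < alpha < 1) (avgT : averaged alpha T).

Lemma averaged_nonexpansive x y : `|T x - T y| <= `|x - y|.
Proof.
rewrite -(ler_pXn2r (n := 2)) ?nnegrE//; apply: le_trans (avgT x y) _.
case/andP: alphaP => a0 a1.
by rewrite gerDl oppr_le0 mulr_ge0 ?sqr_ge0// divr_ge0 ?ltW// subr_gt0.
Qed.

(** A reformulation of nonexpansiveness, which reduces the demiclosedness of id
    - T to that of cocoercive operators. *)
Lemma residual_cocoercive x y :
  2^-1 * '[(x - T x) - (y - T y), (x - T x) - (y - T y)] <=
  '[x - y, (x - T x) - (y - T y)].
Proof.
have : `|T x - T y| ^+ 2 <= `|x - y| ^+ 2.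
  by rewrite ler_pXn2r ?nnegrE// averaged_nonexpansive.
rewrite !norm_inner.
rewrite (_ : T x - T y = (x - y) - ((x - T x) - (y - T y))); last by vector_eq.
move: (x - T x - (y - T y)) (x - y) => v w.
by rewrite !innerE (innerC v w); lra.
Qed.

Lemma averaged_fixed_decrease (kappa : R) x xh : kappa <= (1 - alpha) / alpha ->
  T xh = xh -> `|T x - xh| ^+ 2 + kappa * `|x - T x| ^+ 2 <= `|x - xh| ^+ 2.
Proof.
move=> ka fixh; have := avgT x xh; rewrite fixh subrr subr0.
by have := ler_wpM2r (sqr_ge0 `|x - T x|) ka; lra.
Qed.

Lemma averaged_demiclosed (F : set_system nat) {FF : ProperFilter F} (M : R)
    (y : nat -> V) (l : V) :
  (\forall k \near F, `|y k| <= M) -> weak_cvg F y l ->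
  (fun k => y k - T (y k)) @ F --> 0 -> T l = l.
Proof.
move=> yM yl y0; apply/eqP; rewrite eq_sym -subr_eq0; apply/eqP.
apply: (@cocoercive_demiclosed R V F FF 2^-1 M (fun v => v - T v) y l 0) => //.
exact: residual_cocoercive.
Qed.

End averaged_operators.

Lemma averaged_uniform_constant {R : realType} (I : finType) (Q : pred I)
    (alpha : I -> R) : (forall i, Q i -> 0 < alpha i < 1) ->
  exists2 kappa, 0 < kappa & forall i, Q i -> kappa <= (1 - alpha i) / alpha i.
Proof.
move=> aP; exists (\big[Num.min/1]_(i | Q i) ((1 - alpha i) / alpha i)).
  apply: lt_bigmin => // i Qi; case/andP: (aP i Qi) => a0 a1.
  by rewrite divr_gt0// subr_gt0.
by move=> i Qi; exact: bigmin_le_cond.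
Qed.

(** * Measurability of weak limits *)

Section weak_measurability.
Context {R : realType} {d : measure_display} {Omega : measurableType d}.

(** A countable dense set is replaced by a sequence, so that unions and
    intersections are indexed by the natural numbers. *)
Lemma separable_dense_sequence {V : hilbertType R} : Defs.separable V ->
  exists s : nat -> V, forall O : set V, open O -> O !=set0 -> exists n, O (s n).
Proof.
move=> [S /countable_injP[f finj] dS].
exists (fun n => xget 0 [set v | S v /\ f v = n]) => O oO O0.
have [v [Ov Sv]] := dS O O0 oO; exists (f v).
have [Sx fx] := xgetPex 0 (ex_intro [set w | S w /\ f w = f v] v (conj Sv erefl)).
by rewrite (finj _ _ _ _ fx)// inE.
Qed.

(** As in the theorem of Pettis: by density, |X - a| <= r is a countable
    conjunction of the inequalities <X - a, v> <= r |v|. *)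
Lemma weakly_measurable_closed_ball {V : hilbertType R} (X : Omega -> V) (a : V)
    (r : R) : Defs.separable V -> 0 <= r ->
  (forall v, measurable_fun setT (fun w => '[X w, v])) ->
  measurable [set w | `|X w - a| <= r].
Proof.
move=> /separable_dense_sequence[s sd] r0 mX.
rewrite (_ : [set w | _] = \bigcap_n [set w | '[X w - a, s n] <= r * `|s n|]).
  apply: bigcap_measurableType => n _.
  have mY : measurable_fun setT (fun w => '[X w - a, s n]).
    rewrite (_ : (fun w => _) = fun w => '[X w, s n] - '[a, s n]).
      by apply: measurable_funB.
    by apply/funext => w; rewrite innerDl innerNl.
  have := mY measurableT _ (measurable_itv `]-oo, (r * `|s n|)]).
  rewrite setTI; congr measurable.
apply/seteqP; split => w /= h.
  move=> n _ /=; apply: le_trans (inner_le _ _) _.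
  by rewrite ler_wpM2r.
have key v : '[X w - a, v] <= r * `|v|.
  rewrite leNgt; apply/negP => lt.
  pose O := [set v' | 0 < '[X w - a, v'] - r * `|v'|].
  have oO : open O.
    apply: (@open_comp _ _ (fun v' => '[X w - a, v'] - r * `|v'|) [set t | 0 < t]).
      move=> v' _; apply: cvgB; first by apply: cvg_inner; [exact: cvg_cst|exact: cvg_id].
      by apply: cvgMl_tmp; apply: cvg_norm; exact: cvg_id.
    exact: open_gt.
  have [|n] := sd O oO; first by exists v; rewrite /O /= subr_gt0.
  by rewrite /O /= subr_gt0 ltNge (h n).
have := key (X w - a); rewrite -norm_inner expr2.
have [->|] := eqVneq (`|X w - a|) 0; first by rewrite mulr0.
by move=> n0; rewrite ler_pM2r// lt_def n0 normr_ge0.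
Qed.

(** Every open set of the product is a countable union of products of closed
    balls centred at the points of dense sequences. *)
Lemma weakly_measurable_pair {H G : hilbertType R} (X : Omega -> H) (U : Omega -> G) :
  Defs.separable H -> Defs.separable G ->
  (forall v, measurable_fun setT (fun w => '[X w, v])) ->
  (forall v, measurable_fun setT (fun w => '[U w, v])) ->
  @measurable_fun _ _ Omega (g_sigma_algebraType (@open (H * G)%type)) setT
    (fun w => (X w, U w)).
Proof.
move=> sH sG mX mU.
have [sx sxd] := separable_dense_sequence sH.
have [su sud] := separable_dense_sequence sG.
apply: (@measurability d _ Omega (g_sigma_algebraType (@open (H * G)%type)) setT
  (fun w => (X w, U w)) (@open (H * G)%type) erefl).
move=> _ [ O oO <-].
rewrite setTI.
pose B (i j n : nat) : set (H * G) :=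
  [set z | `|z.1 - sx i| <= harmonic n /\ `|z.2 - su j| <= harmonic n].
pose E i j n : set Omega := [set w | `|X w - sx i| <= harmonic n] `&`
  [set w | `|U w - su j| <= harmonic n].
have mE i j n : measurable (E i j n).
  by apply: measurableI; apply: weakly_measurable_closed_ball => //; exact: harmonic_ge0.
rewrite (_ : _ @^-1` O = \bigcup_i \bigcup_j \bigcup_n
    (if `[< B i j n `<=` O >] then E i j n else set0)).
  apply: bigcupT_measurable => i; apply: bigcupT_measurable => j.
  by apply: bigcupT_measurable => n; case: ifP.
apply/seteqP; split => w /=; last first.
  move=> [i _ [j _ [n _]]]; case: asboolP => // BO [Xi Uj].
  exact: BO.
move=> Ow; have /nbhs_ballP[e /= e0 eO] := open_nbhs_nbhs (conj oO Ow).
have [n ne] : exists n, 2 * harmonic n < e :> R.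
  have /cvgr0Pnorm_lt/(_ (e / 2)) := @cvg_harmonic R.
  rewrite divr_gt0// => /(_ erefl)[n _ /(_ n (leqnn n))] /=.
  by rewrite gtr0_norm// => lt; exists n; rewrite mulrC -ltr_pdivlMr.
have hn : 0 < harmonic n :> R by exact: harmonic_gt0.
have near_point (V : hilbertType R) (s : nat -> V) (v : V) :
    (forall O : set V, open O -> O !=set0 -> exists n, O (s n)) ->
    exists i, `|v - s i| < harmonic n.
  move=> sd; have [|i] := sd (ball v (harmonic n)) (ball_open _ _).
    by exists v; exact: ballxx.
  by rewrite -ball_normE; exists i.
have [i Xi] := near_point H sx (X w) sxd.
have [j Uj] := near_point G su (U w) sud.
exists i => //; exists j => //; exists n => //.
rewrite asboolT; first by split => /=; exact: ltW.
move=> z [z1 z2]; apply: eO.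
by split; rewrite -ball_normE /=;
  [rewrite (_ : X w - z.1 = (X w - sx i) - (z.1 - sx i))
  |rewrite (_ : U w - z.2 = (U w - su j) - (z.2 - su j))];
  try vector_eq; apply: le_lt_trans (ler_normB _ _) _; lra.
Qed.

(** On a measurable null set that contains all the paths without a limit in Z,
    both the sequence and the limit are replaced by a point of Z. The new
    sequence converges weakly everywhere, so its limit is weakly measurable. *)
Lemma ae_weak_limit_random_variable {H G : hilbertType R} (P : probability Omega R)
    (Z : set (H * G)) (x : nat -> Omega -> H) (u : nat -> Omega -> G) :
  Defs.separable H -> Defs.separable G -> Z !=set0 ->
  (forall k v, measurable_fun setT (fun w => '[x k w, v])) ->
  (forall k v, measurable_fun setT (fun w => '[u k w, v])) ->
  {ae P, forall w, exists2 z, Z z &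
    weak_cvg \oo (x ^~ w) z.1 /\ weak_cvg \oo (u ^~ w) z.2} ->
  exists X : {RV P >-> g_sigma_algebraType (@open (H * G)%type)},
    (forall w, Z (X w)) /\
    {ae P, forall w, dsum_weak_cvg (fun k => (x k w, u k w)) (X w)}.
Proof.
move=> sH sG [z0 Zz0] mx mu [N [mN PN sN]].
(* the set of the paths without a limit need not be measurable, whence N *)
pose x' k w := if `[< N w >] then z0.1 else x k w.
pose u' k w := if `[< N w >] then z0.2 else u k w.
have mixed (V : hilbertType R) (y : Omega -> V) (c v : V) :
    measurable_fun setT (fun w => '[y w, v]) ->
    measurable_fun setT (fun w => '[if `[< N w >] then c else y w, v]).
  move=> my; rewrite (_ : (fun w => _) = fun w => \1_N w * '[c, v] +
      \1_(~` N) w * '[y w, v]).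
    by apply: measurable_funD; apply: measurable_funM => //;
      apply: measurable_indic => //; exact: measurableC.
  apply/funext => w; rewrite !indicE in_setC.
  have [Nw|Nw] := pselect (N w).
    by rewrite asboolT// mem_set//= mul1r mul0r addr0.
  by rewrite asboolF// memNset//= mul0r mul1r add0r.
have /choice[X XP] : forall w, exists z, Z z /\
    weak_cvg \oo (x' ^~ w) z.1 /\ weak_cvg \oo (u' ^~ w) z.2.
  move=> w; rewrite /x' /u'; case: asboolP => Nw.
    by exists z0; split => //; split; apply: cvg_weak; exact: cvg_cst.
  have [z Zz zw] : exists2 z, Z z &
      weak_cvg \oo (x ^~ w) z.1 /\ weak_cvg \oo (u ^~ w) z.2.
    by apply: contrapT => h; apply: Nw; exact: sN.
  by exists z.
have mX : @measurable_fun _ _ Omega (g_sigma_algebraType (@open (H * G)%type))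
    setT X.
  rewrite (_ : X = fun w => ((X w).1, (X w).2)); last first.
    by apply/funext => w; rewrite -surjective_pairing.
  apply: weakly_measurable_pair => // v.
    apply: (@measurable_fun_cvg _ _ _ _ (fun k w => '[x' k w, v])) => [k|w _].
      exact: mixed.
    exact: (XP w).2.1.
  apply: (@measurable_fun_cvg _ _ _ _ (fun k w => '[u' k w, v])) => [k|w _].
    exact: mixed.
  exact: (XP w).2.2.
exists (mfun_Sub (mem_set mX)); split => [w|]; first exact: (XP w).1.
exists N; split => // w; apply: contra_notP => Nw v.
have [_ [xw uw]] := XP w; move: xw uw; rewrite /x' /u' asboolF//= => xw uw.
by rewrite /dsum_inner /=; apply: cvgD; [exact: xw|exact: uw].
Qed.

End weak_measurability.

(** * Convergence of the random algorithm *)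

Lemma in_bigcup_nat (I : finType) (F : nat -> {set I}) (i : I) m n :
  i \in (\bigcup_(m <= k < n) F k)%SET ->
  exists2 k, (m <= k < n)%N & i \in F k.
Proof.
rewrite (big_morph (fun A : {set I} => i \in A) (id1 := false) (op1 := orb)); last 2 first.
- by move=> A B; rewrite inE.
- by rewrite inE.
rewrite big_has => /hasP[k]; rewrite mem_index_iota => mkn iF.
by exists k.
Qed.

(** A positive lower bound in the extended reals is replaced by a real one,
    which can be 1 if the infimum is infinite. *)
Lemma ereal_inf_bigmin_gt0 {R : realType} (I : finType) (Q : nat -> {set I})
    (pr : nat -> I -> \bar R) :
  (0 < ereal_inf (range (fun k => \big[mine/+oo]_(i in Q k) pr k i)))%E ->
  exists2 zeta : R, 0 < zeta & forall k i, i \in Q k -> (zeta%:E <= pr k i)%E.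
Proof.
set e := ereal_inf _ => e0.
have lb k i : i \in Q k -> (e <= pr k i)%E.
  move=> iQ; apply: (@le_trans _ _ (\big[mine/+oo]_(j in Q k) pr k j)%E).
    by apply: ereal_inf_lbound; exists k.
  exact: bigmin_le_cond.
have [zeta zeta0 ze] : exists2 zeta : R, 0 < zeta & (zeta%:E <= e)%E.
  case: (e) e0 => [r| |] //; last by exists 1 => //; rewrite leey.
  by rewrite lte_fin; exists r.
by exists zeta => // k i /lb; exact: le_trans.
Qed.

Theorem theorem3p1 (R : realType) (H G : hilbertType R)
  (sepH : separable H) (sepG : separable G)
  (A : H -> set H) (B D : G -> set G) (C : H -> H) (L : {linear H -> G})
  (delta mu : R)
  (maxA : maximally_monotone A) (maxB : maximally_monotone B)
  (maxD : maximally_monotone D)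
  (delta_gt0 : 0 < delta) (strD : strongly_monotone delta D)
  (mu_gt0 : 0 < mu) (cocC : cocoercive mu (single_valued C))
  (bndL : bounded_near L (nbhs (0 : H))) (neqL0 : exists x, L x != 0)
  (m : nat) (m_ge1 : (1 <= m)%N)
  (T : 'I_m.+1 -> H -> H) (alpha : 'I_m.+1 -> R)
  (T0 : T ord0 = id)
  (alphaP : forall i : 'I_m.+1, i != ord0 -> 0 < alpha i < 1)
  (avgT : forall i : 'I_m.+1, i != ord0 -> averaged (alpha i) (T i))
  (S : set H) (SE : S = \bigcap_(i in [set i : 'I_m.+1 | i != ord0]) Fix (T i))
  (Z0 : set (H * G)) (Z0E : Z0 = primal_dual_solutions A B D C L)
  (Z : set (H * G)) (ZE : Z = (S `*` [set: G]) `&` Z0) (Z_neq0 : Z !=set0)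
  (tau gamma : R)
  (tauP : 0 < tau < 2 * mu) (gammaP : 0 < gamma < 2 * delta)
  (Lbnd : opnorm L ^+ 2 <
    (gamma^-1 - (2 * delta)^-1) * (tau^-1 - (2 * mu)^-1))
  (x0 xbar0 : H) (u0 : G) (x0E : x0 = xbar0)
  (d : measure_display) (Omega : measurableType d) (P : probability Omega R)
  (eps : nat -> {RV P >-> 'I_m.+1}) (indep : independent P eps)
  (I : nat -> {set 'I_m.+1})
  (IE : forall k, range (eps k) = [set` I k])
  (x xbar p : nat -> Omega -> H) (u : nat -> Omega -> G)
  (xI : forall w, x 0%N w = x0) (xbarI : forall w, xbar 0%N w = xbar0)
  (uI : forall w, u 0%N w = u0)
  (uS : forall k w, u k.+1 w =
    value (resolvent (scale_op gamma (inverse B)))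
      (u k w + gamma *: (L (xbar k w) - value (inverse D) (u k w))))
  (pS : forall k w, p k.+1 w =
    value (resolvent (scale_op tau A))
      (x k w - tau *: (adjoint L (u k.+1 w) + C (x k w))))
  (xS : forall k w, x k.+1 w = T (eps k.+1 w) (p k.+1 w))
  (xbarS : forall k w, xbar k.+1 w = x k.+1 w + p k.+1 w - x k w)
  (cond :
    Z0 `<=` S `*` [set: G] \/
    (exists2 N : nat, (0 < N)%N &
       forall n, (\bigcup_(n <= k < n + N) I k)%SET = [set: 'I_m.+1]%SET) /\
    (0 < ereal_inf (range (fun k =>
       \big[mine/+oo]_(i in (I k :\ ord0)%SET) P (eps k @^-1` [set i]))))%E) :
  exists X : {RV P >-> g_sigma_algebraType (@open (H * G)%type)},
    (forall w, Z (X w)) /\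
    {ae P, forall w, dsum_weak_cvg (fun k => (x k w, u k w)) (X w)}.
Proof.
subst Z Z0; have [z [[Sz _] Zz]] := Z_neq0.
have [kappa kappa0 kappaP] := averaged_uniform_constant alphaP.
have fixS i y : i != ord0 -> S y -> T i y = y.
  by move=> i0; rewrite SE => /(_ i); exact.
have xd w k y : S y -> `|x k.+1 w - y| ^+ 2 +
    kappa * `|p k.+1 w - x k.+1 w| ^+ 2 <= `|p k.+1 w - y| ^+ 2.
  move=> Sy; rewrite xS; have [->|i0] := eqVneq (eps k.+1 w) ord0.
    by rewrite T0 subrr normr0 expr0n mulr0 addr0.
  exact: (averaged_fixed_decrease (avgT _ i0) _ (kappaP _ i0) (fixS _ _ i0 Sy)).
have xbar0E w : xbar 0%N w = x 0%N w by rewrite xI xbarI.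
have path w := @iterates_weak_cvg _ _ _ _ _ _ _ _ _ _ _ _ maxA maxB maxD delta_gt0
  strD mu_gt0 cocC bndL tauP gammaP Lbnd S kappa (x ^~ w) (xbar ^~ w) (p ^~ w)
  (u ^~ w) kappa0 (uS ^~ w) (pS ^~ w) (xd w) (xbarS ^~ w) z Sz Zz.
have summ w := @activation_increment_summable _ _ _ _ _ _ _ _ _ _ _ _ maxA maxB
  maxD delta_gt0 strD mu_gt0 cocC bndL tauP gammaP Lbnd S kappa (x ^~ w)
  (xbar ^~ w) (p ^~ w) (u ^~ w) kappa0 (xbar0E w) (uS ^~ w) (pS ^~ w) (xd w)
  (xbarS ^~ w) z Sz Zz.
have dp w := @consecutive_resolvents_cvg0 _ _ _ _ _ _ _ _ _ _ _ _ maxA maxB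
  maxD delta_gt0 strD mu_gt0 cocC bndL tauP gammaP Lbnd S kappa (x ^~ w)
  (xbar ^~ w) (p ^~ w) (u ^~ w) kappa0 (uS ^~ w) (pS ^~ w) (xd w)
  (xbarS ^~ w) z Sz Zz.
have bp w := @resolvents_bounded _ _ _ _ _ _ _ _ _ _ _ _ maxA maxB
  maxD delta_gt0 strD mu_gt0 cocC bndL tauP gammaP Lbnd S kappa (x ^~ w)
  (xbar ^~ w) (p ^~ w) (u ^~ w) kappa0 (uS ^~ w) (pS ^~ w) (xd w)
  (xbarS ^~ w) z Sz Zz.
have wp w F (PF : ProperFilter F) := @resolvents_weak_cluster _ _ _ _ _ _ _ _ _ _ _ _
  maxA maxB maxD delta_gt0 strD mu_gt0 cocC bndL tauP gammaP Lbnd S kappa (x ^~ w)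
  (xbar ^~ w) (p ^~ w) (u ^~ w) kappa0 (uS ^~ w) (pS ^~ w) (xd w)
  (xbarS ^~ w) z Sz Zz F PF.
(* x_k, xbar_k and u_k depend on eps_1, ..., eps_k, and p_(k+1) on no other activation *)
have detxu k : history_determined eps k (fun w => (x k w, xbar k w, u k w)).
  elim: k => [|k ih] w w' ww'; first by rewrite !xI !xbarI !uI.
  have [ex eb eu] : (x k w, xbar k w, u k w) = (x k w', xbar k w', u k w').
    by apply: ih => j jk; apply: ww'; exact: ltnW.
  have eu' : u k.+1 w = u k.+1 w' by rewrite !uS eb eu.
  have ep : p k.+1 w = p k.+1 w' by rewrite !pS eu' ex.
  have ex' : x k.+1 w = x k.+1 w' by rewrite !xS ep ww'.
  by rewrite !xbarS ex' ep ex eu'.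
have detp k : history_determined eps k (p k.+1).
  move=> w w' ww'; have [ex eb eu] := detxu k w w' ww'.
  have eu' : u k.+1 w = u k.+1 w' by rewrite !uS eb eu.
  by rewrite !pS eu' ex.
apply: ae_weak_limit_random_variable => //.
- move=> k v; apply: (@history_determined_measurable _ _ _ _ _ eps k) => w w' ww'.
  by have [-> _ _] := detxu k w w' ww'.
- move=> k v; apply: (@history_determined_measurable _ _ _ _ _ eps k) => w w' ww'.
  by have [_ _ ->] := detxu k w w' ww'.
suff : {ae P, forall w, primal_dual_solutions A B D C L `<=` S `*` [set: G] \/
    forall i, i != ord0 -> (fun k => p k.+1 w - T i (p k.+1 w)) @ \oo --> 0}.
  apply: filterS => w good.
  have [|z' [Sz' Zz' xz' uz']] := path w; last by exists z'.
  move=> F PF oF l Zl xl; case: good => [/(_ _ Zl)[]//|res].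
  rewrite SE => i i0; have [M pM] := bp w.
  apply: (@averaged_demiclosed _ _ _ _ (alphaP _ i0) (avgT _ i0) F PF M
    (fun k => p k.+1 w)).
  - exact: oF.
  - exact: wp.
  - by apply: cvg_trans (res i i0) => Q /oF.
case: cond => [inS|[[N N0 cover] inf0]].
  by apply: aeW => w; left.
have [zeta zeta0 zetaP] := ereal_inf_bigmin_gt0 inf0.
pose f k i w := `|p k.+1 w - T i (p k.+1 w)| ^+ 2.
have detf k i : history_determined eps k (f k i).
  by move=> w w' ww'; rewrite /f (detp k w w' ww').
have zetaP' k i : i \in (I k.+1 :\ ord0)%SET ->
    (zeta%:E <= P (eps k.+1 @^-1` [set i]))%E by exact: zetaP.
(* the initial energy bounds the sums on all paths, as the starting points are constant *)
pose K := (tau^-1 * `|x0 - z.1| ^+ 2 + gamma^-1 * `|u0 - z.2| ^+ 2) /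
  (tau^-1 * kappa).
have sumK w n : \sum_(k < n) f k (eps k.+1 w) w <= K.
  have := summ w n; rewrite xI uI; apply: le_trans.
  by apply: ler_sum => k _; rewrite /f xS.
have f0 k i w : 0 <= f k i w by exact: sqr_ge0.
apply: filterS (conditionally_summable_cvg0 indep detf f0 zeta0 zetaP' sumK).
move=> w res; right => i i0; apply: norm_cvg0.
apply: (@window_cvg0 _ (fun k => `|p k.+1 w - T i (p k.+1 w)|)
  (fun k => 2 * `|p k.+2 w - p k.+1 w|) (fun k => i \in I k.+1) N).
- move=> k; apply: le_trans (ler_dist_dist _ _) _.
  rewrite (_ : _ - _ = (p k.+2 w - p k.+1 w) -
    (T i (p k.+2 w) - T i (p k.+1 w))); last by vector_eq.
  apply: le_trans (ler_normB _ _) _.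
  have := averaged_nonexpansive (alphaP _ i0) (avgT _ i0) (p k.+2 w) (p k.+1 w).
  lra.
- by rewrite -[X in _ --> X](mulr0 2); apply: cvgMl_tmp; apply/norm_cvg0P; exact: dp.
(* p_(k+1) is followed by the activation eps_(k+1), hence the window starts at n + 1 *)
- move=> n; have : i \in (\bigcup_(n.+1 <= k < n.+1 + N) I k)%SET.
    by rewrite cover inE.
  by move=> /in_bigcup_nat[[|k]//]; rewrite ltnS addSn ltnS => nk Ik; exists k.
- move=> e e0; have e2 : 0 < e ^+ 2 by rewrite exprn_gt0.
  move/cvgr0Pnorm_le : res => /(_ _ e2); apply: filterS => k hk iI.
  rewrite normr_id -(ler_pXn2r (n := 2)) ?nnegrE ?(ltW e0)//.
  apply: le_trans hk; apply: le_trans (ler_norm _).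
  rewrite (bigD1 i) ?inE ?i0//= lerDl.
  by apply: sumr_ge0 => j _; exact: f0.
Qed.
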